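(* Let $q$ be a prime power, $F_q$ the field with $q$ elements, $V=F_q^n$, and $1<k<n-1$. Let $S$ be a $(k-1)$-dimensional non-degenerate linear code in $V$ which is not projective, with generator matrix $M$. Then $[S\rangle^{\Pi}_{k}$ is a star of $\Pi[n,k]_q$ if and only if $l(k_j)\le q$ for all columns $k_j$ of $M$ and one of the following holds: (1) $q=2$ and either $l(S)=k=3$ and $n=6$, or $l(S)\ge k+1$; (2) $q=3$ and either $l(S)=k-1$ and $|L|\ge 3$, or $l(S)=k$ and $|L|\ge2$, or $l(S)\ge k+1$; (3) $q=4$ and either $l(S)=k-1=1$, or $l(S)=k-1$ and $|L|\ge 2$, or $l(S)\ge k$; (4) $q\ge 5$. Here $L$ is the set of equivalence classes of columns of $M$ containing more than one column.
   Context: A linear code $[n,k]_q$ is a $k$-dimensional subspace of $V=F_q^n$; a generator matrix is a matrix whose rows form a basis of it. A code is non-degenerate if its generator matrix has no zero column, and projective if the columns of a generator matrix are non-zero and pairwise non-proportional. $\Pi(n,k)_q$ denotes the set of all $k$-dimensional projective codes in $V$, and $\Pi[n,k]_q$ is the simple graph with vertex set $\Pi(n,k)_q$ in which two distinct codes are adjacent iff their intersection is $(k-1)$-dimensional. A clique is a set of pairwise adjacent vertices; it is maximal if not properly contained in another clique. $[S\rangle^{\Pi}_{k}$ denotes the set of all elements of $\Pi(n,k)_q$ containing $S$; it is called a star of $\Pi[n,k]_q$ if it is a maximal clique of $\Pi[n,k]_q$. Two columns $c,c'$ of $M$ are called equivalent if $c'=\lambda c$ for some nonzero $\lambda\in F_q$;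 $l(k_j)$ is the number of columns in the equivalence class of the column $k_j$, and $l(S)$ is the number of equivalence classes (these do not depend on the choice of generator matrix).
   Formalization: Cliques are required to be non-empty: if Π[n,k]_q has no vertices, the empty set would literally be a maximal clique and the claim fails (q=2, k=2, n=4, S spanned by (1,1,1,1), where l(k_j)=4>q). Nothing changes when the graph has a vertex. *)

(* Defs.v *)
From HB Require Import structures.
From mathcomp Require Import all_boot all_order all_algebra.
From mathcomp Require Import boolp classical_sets.

Set Implicit Arguments.
Unset Strict Implicit.
Unset Printing Implicit Defensive.

Import GRing.Theory.

Local Open Scope classical_set_scope.
Local Open Scope ring_scope.

Section Cliques.
Variables (T : Type) (V : set T) (adj : T -> T -> Prop).

(* Cliques are non-empty.  This matters only for a graph without vertices,
   which thus has no maximal clique: a set consisting of one vertex is a clique,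
   so in a graph that has a vertex the empty set is never maximal. *)
Definition clique (X : set T) : Prop :=
  [/\ X `<=` V, X !=set0
    & forall x y, X x -> X y -> x <> y -> adj x y].

Definition maximal_clique (X : set T) : Prop :=
  clique X /\ forall Y, clique Y -> ~ (X `<` Y).

End Cliques.

Section Columns.
Variables (F : finFieldType) (m n : nat) (M : 'M[F]_(m, n)).

Definition col_equiv (i j : 'I_n) : bool :=
  [exists a : F, (a != 0) && (col j M == a *: col i M)].

(* Classes of columns are sets of column indices: equal columns in distinct
   positions are counted separately. *)
Definition col_class (j : 'I_n) : {set 'I_n} := [set i | col_equiv j i]%SET.

Definition col_classes : {set {set 'I_n}} :=
  equivalence_partition col_equiv [set: 'I_n]%SET.

Definition repeated_col_classes : {set {set 'I_n}} :=
  [set X in col_classes | (1 < #|X|)%N]%SET.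

Definition nondegenerate_mx : Prop := forall j : 'I_n, col j M != 0.

Definition projective_mx : Prop :=
  nondegenerate_mx /\ forall i j : 'I_n, i != j -> ~~ col_equiv i j.

End Columns.

Section Codes.
Variables (F : finFieldType) (n : nat).
Implicit Types C D S : {vspace 'rV[F]_n}.

Definition generator_matrix m (M : 'M[F]_(m, n)) C : bool :=
  basis_of C [seq row i M | i : 'I_m].

(* Two generator matrices of C differ by an invertible left factor, so the next
   two properties do not depend on the matrix chosen. *)
Definition nondegenerate_code C : Prop :=
  exists m (M : 'M[F]_(m, n)), generator_matrix M C /\ nondegenerate_mx M.

Definition projective_code C : Prop :=
  exists m (M : 'M[F]_(m, n)), generator_matrix M C /\ projective_mx M.

Definition projective_codes (k : nat) : set {vspace 'rV[F]_n} :=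
  [set C | \dim C = k /\ projective_code C].

Definition code_adj (k : nat) C D : Prop :=
  C <> D /\ \dim (C :&: D)%VS = k.-1.

Definition codes_above (k : nat) S : set {vspace 'rV[F]_n} :=
  [set C | projective_codes k C /\ (S <= C)%VS].

Definition is_star (k : nat) (X : set {vspace 'rV[F]_n}) : Prop :=
  maximal_clique (projective_codes k) (code_adj k) X.

End Codes.

(* Main.v *)
(** Dividing each column of [M] by its ratio to a representative of its class
    makes every word of [S] constant on the column classes, and a code
    [S + <[v]>] is projective iff the scaled word [v] is injective on each class
    (below, [v] is _good_).  So there is such a code iff no class has more than
    [q] elements.  A projective code [D] that would extend the clique does not
    contain [S], and [S + D] has dimension [k + 1] and contains every good word;
    hence the star is maximal when the span [E] of the good words has dimension
    at least [k + 2].  Replacing one coordinate of a good word, or swapping two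
    of them, shows that [E] contains all words summing to zero on each class of
    size [q]; it equals this space if [q > 2], since the elements of [F] then
    sum to zero, and has one more dimension if [q = 2].

    When [dim E <= k + 1], an obstructing [D] is a hyperplane, in a space of
    dimension [k + 1] containing [E], given by a functional that does not vanish
    on [S] and is not a combination of two coordinates there.  It exists except
    for [q = 4, k = 2, n = 4] and [q = 2, k = 3, n = 6], where every functional
    on [E] that is not such a combination vanishes on [S]. *)

Require Import Defs.
From HB Require Import structures.
From mathcomp Require Import all_boot all_order all_algebra.
From mathcomp Require Import boolp classical_sets.
From mathcomp Require Import perm zify.

Set Implicit Arguments.
Unset Strict Implicit.
Unset Printing Implicit Defensive.

Import GRing.Theory.

Local Open Scope classical_set_scope.
Local Open Scope ring_scope.

(** * Linear functionals and hyperplanes *)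

Section Functionals.
Variables (K : fieldType) (vT : vectType K).
Implicit Types (D E : {vspace vT}) (f phi : 'Hom(vT, K^o)).

Lemma dim_cap_lker E phi u : u \in E -> phi u != 0 ->
  (\dim (E :&: lker phi)).+1 = \dim E.
Proof.
move=> uE phiu; have := limg_ker_dim phi E.
have : (\dim (phi @: E) <= 1)%N.
  by have := dimvS (subvf (phi @: E)%VS); rewrite dimvf.
have : (\dim (phi @: E) != 0)%N.
  rewrite dimv_eq0; apply/eqP=> E0; have := memv_img phi uE.
  by rewrite E0 memv0 (negPf phiu).
lia.
Qed.

(** Subtracting a multiple of [u] brings every vector of [E] into the kernel of [phi], where [f]
    vanishes. *)
Lemma functional_factor E f phi u : u \in E -> phi u != 0 ->
    (forall w, w \in E -> phi w = 0 -> f w = 0) ->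
  exists c, forall w, w \in E -> f w = c * phi w.
Proof.
move=> uE phiu fphi; exists (f u / phi u) => w wE.
have: f (w - (phi w / phi u) *: u) = 0.
  apply: fphi; first by rewrite memvB ?memvZ.
  by rewrite linearB linearZ /= /GRing.scale /= divfK ?subrr.
rewrite linearB linearZ /= /GRing.scale /= => /eqP; rewrite subr_eq0 => /eqP->.
by rewrite mulrC mulrA mulrAC.
Qed.

(** For a vector [v] of [E] outside [D], [phi] projects [<[v]> + D] onto [<[v]>] and reads the
    coefficient of [v]. *)
Lemma hyperplane_functional D E : (D <= E)%VS -> \dim E = (\dim D).+1 ->
  exists phi : 'Hom(vT, K^o), forall u, u \in E -> (u \in D) = (phi u == 0).
Proof.
move=> DE dimE.
have /subvPn[v vE vD] : ~~ (E <= D)%VS.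
  by apply/negP=> /dimvS; rewrite dimE ltnn.
have v0 : v != 0 by apply: contraNneq vD => ->; rewrite mem0v.
have VD0 : (<[v]> :&: D = 0)%VS.
  apply/eqP; rewrite -subv0; apply/subvP=> w /memv_capP[/vlineP[c ->] cD].
  rewrite memv0; apply: contraR vD; rewrite scaler_eq0 negb_or => /andP[c0 _].
  by rewrite -[v]scale1r -(mulVf c0) -scalerA memvZ.
have EDv : E = (<[v]> + D)%VS.
  apply/esym/eqP; rewrite eqEdim subv_add DE -memvE vE /= dimv_disjoint_sum //.
  by rewrite dim_vline v0 dimE add1n.
pose phi := (linfun (coord [tuple v] ord0 : {linear vT -> K^o}) \o daddv_pi
  <[v]> D)%VF.
exists phi => u; rewrite EDv => uE; rewrite comp_lfunE lfunE /=.
have uE' := daddv_pi_add VD0 uE.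
have := memv_pi <[v]> D u; have vDu := memv_pi D <[v]> u.
move: uE' vDu; set a := daddv_pi <[v]> D u; set b := daddv_pi D <[v]> u.
move=> <- bD av.
have acD : a = coord [tuple v] ord0 a *: v.
  by rewrite {1}(@coord_span _ _ _ [tuple v] a) ?big_ord1 // span_seq1.
rewrite rpredDr //; apply/idP/eqP => [aD|c0].
  have: a \in (<[v]> :&: D)%VS by apply/memv_capP.
  rewrite VD0 memv0 => /eqP a0.
  by rewrite a0 linear0.
by rewrite acD c0 scale0r mem0v.
Qed.

End Functionals.

(** * Maximality of the clique above a code *)

Section StarCriterion.
Variables (F : finFieldType) (n k : nat) (S : {vspace 'rV[F]_n}).
Hypotheses (k_gt0 : (0 < k)%N) (dimS : \dim S = k.-1).

Lemma dim_cap_above C D : \dim C = k -> \dim D = k -> (S <= C)%VS ->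
  (S <= D)%VS -> C <> D -> \dim (C :&: D) = k.-1.
Proof.
move=> dC dD SC SD CD; apply/eqP; rewrite eqn_leq.
rewrite -{2}dimS dimvS ?subv_cap ?SC // andbT -ltnS prednK // ltnNge -{1}dC.
apply/negP=> dCD; apply: CD; apply/eqP; rewrite eqEdim dC dD leqnn andbT.
have /eqP <- : (C :&: D == C)%VS by rewrite eqEdim capvSl dCD.
exact: capvSr.
Qed.

(** A vertex by which the clique could be enlarged. It differs from each [C] because [C] contains
    [S] and [D] does not. *)
Definition star_blocker (D : {vspace 'rV[F]_n}) : Prop :=
  [/\ projective_codes k D, ~~ (S <= D)%VS
    & forall C, codes_above k S C -> \dim (C :&: D) = k.-1].

(** The codes above [S] are pairwise adjacent, so maximality fails only when there are none or when
    some outside vertex is adjacent to all of them. *)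
Lemma is_star_blocker : is_star k (codes_above k S) <->
  (exists C, codes_above k S C) /\ ~ (exists D, star_blocker D).
Proof.
split=> [[[_ X0 _] maxX]|[X0 noD]].
  split=> // -[D [pD SD XD]].
  apply: (maxX (codes_above k S `|` [set D])%classic).
    split; last 1 first.
    - have D_C C : codes_above k S C -> D <> C.
        by move=> [_ SC] DC; move: SD; rewrite DC SC.
      move=> x y [Xx|->] [Xy|->] xy; split=> //.
      + by case: Xx Xy => [[dx _] Sx] [[dy _] Sy]; exact: dim_cap_above.
      + exact: XD.
      + by rewrite capvC XD.
    - by move=> x [[]|->].
    - by case: X0 => C XC; exists C; left.
  split=> [C XC|sub]; first by left.
  by have [_] := sub D (or_intror erefl); apply/negP.
split; first split=> //.
- by move=> C [].
- move=> x y [[dx _] Sx] [[dy _] Sy] xy; split=> //.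
  exact: dim_cap_above.
move=> Y [YP Y0 Yadj] [XY YX]; apply: YX => D YD.
have [pD|] := pselect (codes_above k S D); first by [].
move=> nXD; case: noD; exists D; split.
- exact: YP.
- by apply/negP => SD; apply: nXD; split=> //; apply: YP.
- move=> C XC; have [] // := Yadj C D (XY _ XC) YD.
  by move=> CD; apply: nXD; rewrite -CD.
Qed.

(** [C :&: D] does not lie in [S]: otherwise both would be equal by dimension, and [S] would lie in
    [D]. Hence [C = S + (C :&: D)], and [S + D = C + D]. *)
Lemma star_blocker_span D C : star_blocker D -> codes_above k S C ->
  (C <= S + D)%VS /\ \dim (S + D) = k.+1.
Proof.
move=> [[dD _] SD XD] XC; have dCD := XD C XC; have [[dC _] SC] := XC.
have CSD : (C <= S + D)%VS.
  have [/subvP sub|/subvPn[w wCD wS]] := boolP ((C :&: D) <= S)%VS.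
    case/negP: SD; have /eqP<- : ((C :&: D)%VS == S).
      by rewrite eqEdim dCD dimS leqnn andbT; apply/subvP.
    exact: capvSr.
  have /eqP<- : (S + (C :&: D) == C)%VS; last by rewrite addvS ?capvSr.
  rewrite eqEdim subv_add SC capvSl dC -(prednK k_gt0) -dimS /= ltn_neqAle.
  rewrite dimvS ?addvSl // andbT; apply/negP=> /eqP dE.
  have /eqP SE : (S == S + (C :&: D))%VS by rewrite eqEdim addvSl dE leqnn.
  by case/negP: wS; rewrite SE (subvP (addvSr _ _)).
split=> //; have /eqP -> : (S + D == C + D)%VS.
  by rewrite eqEsubv !subv_add CSD !addvSr (subv_trans SC) ?addvSl.
have := dimv_sum_cap C D; rewrite dCD dC dD.
move: k_gt0; lia.
Qed.

(** [C] and [D] are distinct hyperplanes of [E], hence meet in codimension two. *)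
Lemma star_blocker_hyperplane E D :
    (forall C, codes_above k S C -> (C <= E)%VS) -> \dim E = k.+1 ->
    (D <= E)%VS -> projective_codes k D -> ~~ (S <= D)%VS ->
  star_blocker D.
Proof.
move=> XE dE DE pD SD; split=> // C XC.
have [dD _] := pD; have [[dC _] SC] := XC.
have CDE : (\dim (C + D) <= k.+1)%N by rewrite -dE dimvS // subv_add XE.
have : (\dim (C :&: D) < k)%N.
  rewrite ltnNge -{1}dC; apply/negP=> dCD; case/negP: SD.
  have /eqP CDC : (C :&: D == C)%VS by rewrite eqEdim capvSl dCD.
  by rewrite (subv_trans SC) // -CDC capvSr.
have := dimv_sum_cap C D; rewrite dC dD.
move: k_gt0; lia.
Qed.

End StarCriterion.

(** * Columns of generator matrices and coordinates of words *)

Section CodeColumns.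
Variables (F : finFieldType) (n : nat).
Implicit Type C : {vspace 'rV[F]_n}.

(** A relation between columns is a relation on the rows of [M]; it passes to their span, being the
    kernel of the linear map [f]. *)
Lemma generator_colE m (M : 'M[F]_(m, n)) C i j a : generator_matrix M C ->
  col i M = a *: col j M <-> {in C, forall v : 'rV[F]_n, v 0 i = a * v 0 j}.
Proof.
move=> /span_basis <-; split=> [/matrixP colM|colC]; last first.
  apply/matrixP=> r s; rewrite !mxE.
  have /colC : row r M \in <<[seq row i M | i : 'I_m]>>%VS.
    by apply/memv_span/mapP; exists r; rewrite ?mem_enum.
  by rewrite !mxE.
pose f := (linfun (col i) - a *: linfun (col j) : 'Hom('rV[F]_n, 'cV[F]_1))%VF.
have fE v : f v = col i v - a *: col j v.
  by rewrite add_lfunE opp_lfunE scale_lfunE !lfunE.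
suff /subvP sub : (<<[seq row i M | i : 'I_m]>> <= lker f)%VS.
  move=> v /sub; rewrite memv_ker fE subr_eq0 => /eqP/matrixP/(_ 0 0).
  by rewrite !mxE.
apply/span_subvP => _ /mapP[r _ ->]; rewrite memv_ker fE subr_eq0.
by apply/eqP/matrixP=> s t; have := colM r t; rewrite !mxE.
Qed.

Lemma generator_matrix_ex C : exists M : 'M[F]_(\dim C, n), generator_matrix M
  C.
Proof.
exists (\matrix_(i < \dim C) (vbasis C)`_i); rewrite /generator_matrix.
have -> : [seq row i (\matrix_(i < \dim C) (vbasis C)`_i) | i : 'I_(\dim C)]
          = vbasis C; last exact: vbasisP.
apply: (@eq_from_nth _ 0); first by rewrite size_map size_enum_ord size_tuple.
move=> i; rewrite size_map size_enum_ord => ltiC.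
by rewrite (nth_map (Ordinal ltiC)) ?size_enum_ord // rowK nth_enum_ord.
Qed.

(* The coefficient b = 0 covers the condition that no column vanishes. *)
Lemma projective_codeP C : (1 < n)%N ->
  projective_code C <->
  forall i j b, i != j -> exists2 v, v \in C & v 0 i != b * v 0 j.
Proof.
move=> n_gt1; split=> [[m [M [genM [nz npr]]]] i j b ij|sepC].
  apply: contrapT => no; have : col i M = b *: col j M.
    apply/(generator_colE _ _ _ genM) => v vC; apply/eqP.
    by apply: contrapT => /negP neq; apply: no; exists v.
  have [-> /eqP|b0 colM] := eqVneq b 0; first by rewrite scale0r (negPf (nz i)).
  move: (npr j i); rewrite eq_sym ij => /(_ isT)/existsP[].
  by exists b; rewrite b0 colM /=.
have [M genM] := generator_matrix_ex C; exists (\dim C), M; split=> //.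
have ncol i j b : i != j -> col i M <> b *: col j M.
  move=> ij /(generator_colE _ _ _ genM) colC.
  by have [v /colC->] := sepC i j b ij; rewrite eqxx.
split=> [i|i j ij].
  have [j ij] : exists j, i != j.
    have : (0 < #|[pred j | j != i]|)%N by rewrite cardC1 card_ord -ltnS prednK
      // ltnW.
    by case/card_gt0P=> j; rewrite inE eq_sym; exists j.
  by apply/eqP=> coli; apply: (ncol i j 0 ij); rewrite scale0r.
by apply/existsP=> -[a /andP[_ /eqP]]; apply: ncol; rewrite eq_sym.
Qed.

Lemma nondegenerate_codeP C i : nondegenerate_code C ->
  exists2 v, v \in C & v 0 i != 0.
Proof.
move=> [m [M [genM nz]]]; apply: contrapT => no.
have : col i M = 0 *: col i M.
  apply/(generator_colE _ _ _ genM) => v vC; apply/eqP; rewrite mul0r.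
  by apply: contrapT => /negP neq; apply: no; exists v.
by rewrite scale0r => /eqP; rewrite (negPf (nz i)).
Qed.

End CodeColumns.

(** * Words injective on the column classes *)

Section ScaledCoordinates.
Variables (F : finFieldType) (n : nat) (lam : 'I_n -> F) (e : rel 'I_n).
Hypotheses (lam_neq0 : forall i, lam i != 0) (e_equiv : equivalence_rel e).
Implicit Types (u v w g : 'rV[F]_n) (C E : {vspace 'rV[F]_n}) (X : {set 'I_n}).

Local Notation q := #|F|.

Definition scaled_entry i v : F^o := v 0 i / lam i.

Fact scaled_entry_is_linear i : linear (scaled_entry i).
Proof. by move=> a u v; rewrite /scaled_entry !mxE mulrDl -mulrA. Qed.

HB.instance Definition _ i :=
  GRing.isLinear.Build F 'rV[F]_n F^o _ (scaled_entry i)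
    (scaled_entry_is_linear i).

Definition coordf i : 'Hom('rV[F]_n, F^o) := linfun (scaled_entry i).

Definition of_coords (x : 'I_n -> F) : 'rV[F]_n := \row_i (x i * lam i).

Lemma coordfE i v : coordf i v = v 0 i / lam i.
Proof. by rewrite lfunE. Qed.

Lemma of_coordsK x i : coordf i (of_coords x) = x i.
Proof. by rewrite coordfE mxE mulfK. Qed.

Lemma coordf_inj u v : (forall i, coordf i u = coordf i v) -> u = v.
Proof.
move=> uv; apply/rowP=> i; have := uv i; rewrite !coordfE.
by move/(divIf (lam_neq0 i)).
Qed.

Definition separated C := forall i j b, i != j ->
  exists2 v, v \in C & coordf i v != b * coordf j v.

(** The coefficient [b] on rescaled coordinates becomes [b * lam i / lam j] on entries, so
    quantifying over all [b] absorbs the scaling. *)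
Lemma projective_separated C : (1 < n)%N -> projective_code C <-> separated C.
Proof.
move=> /projective_codeP->; split=> sepC i j b ij.
  have [v vC neq] := sepC i j (b * lam i / lam j) ij; exists v => //.
  apply: contraNneq neq; rewrite !coordfE => /(congr1 ( *%R^~ (lam i))).
  by rewrite divfK // => ->; apply/eqP; rewrite -!mulrA; congr (_ * _);
    rewrite mulrC -mulrA mulrCA.
have [v vC neq] := sepC i j (b * lam j / lam i) ij; exists v => //.
apply: contraNneq neq; rewrite !coordfE => ->.
apply/eqP; rewrite [RHS]mulrACA [X in _ = X * _]mulrAC -[RHS]mulrA.
by rewrite [lam j * _]mulrCA divff // mulr1.
Qed.

(** Boolean, so that the good words can be enumerated as generators of [good_span]. *)
Definition good v :=
  [forall i, forall j, (i != j) && e i j ==> (coordf i v != coordf j v)].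

Lemma goodP v :
  reflect (forall i j, i != j -> e i j -> coordf i v != coordf j v) (good v).
Proof.
apply: (iffP 'forall_forallP) => gv i j.
  by move=> ij eij; have := gv i j; rewrite ij eij.
by apply/implyP=> /andP[]; apply: gv.
Qed.

Definition class_constant v := forall i j, e i j -> coordf i v = coordf j v.

Lemma good_addr g u : good g -> class_constant u -> good (g + u).
Proof.
move=> /goodP gg cu; apply/goodP => i j ij eij; rewrite !linearD /= (cu i j) //.
by rewrite (inj_eq (addIr _)) gg.
Qed.

Definition good_span : {vspace 'rV[F]_n} := <<enum good>>%VS.

Lemma good_in_span g : good g -> g \in good_span.
Proof. by move=> gg; apply: memv_span; rewrite mem_enum. Qed.

(** Such a word is the difference of the good words [g + u] and [g]. *)
Lemma class_constant_in_span g u :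
  good g -> class_constant u -> u \in good_span.
Proof.
move=> gg cu; have -> : u = (g + u) - g by rewrite addrC addKr.
by rewrite memvB ?good_in_span ?good_addr.
Qed.

(** * Column classes, full classes and the sums over them *)

Definition classes := equivalence_partition e [set: 'I_n]%SET.
Definition cls i : {set 'I_n} := [set j | e i j]%SET.

Lemma equiv_refl i : e i i. Proof. by case: (e_equiv i i i). Qed.
Lemma equiv_sym i j : e i j = e j i.
Proof.
apply/idP/idP => eij.
  by have [_ /(_ eij)] := e_equiv i j i; rewrite equiv_refl => <-.
by have [_ /(_ eij)] := e_equiv j i j; rewrite equiv_refl => <-.
Qed.
Lemma equiv_left i j : e i j -> e i =1 e j.
Proof. by move=> eij k; have [_ ->] := e_equiv i j k. Qed.

Lemma eq_cls i j : (cls i == cls j) = e i j.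
Proof.
apply/eqP/idP => [/setP/(_ j)|eij]; first by rewrite !inE equiv_refl.
by apply/setP=> k; rewrite !inE (equiv_left eij).
Qed.

Lemma card_cls_gt1 i j : i != j -> e i j -> (1 < #|cls i|)%N.
Proof.
move=> ij eij; have /subset_leq_card : [set i; j]%SET \subset cls i.
  by apply/fintype.subsetP=> l; rewrite !inE => /orP[]/eqP->;
    rewrite ?equiv_refl.
by rewrite cards2 ij.
Qed.

Lemma classesP X : reflect (exists i, X = cls i) (X \in classes).
Proof.
apply: (iffP imsetP) => [[i _ ->]|[i ->]]; exists i => //;
  by apply/setP => j; rewrite !inE.
Qed.

Lemma cls_class i : cls i \in classes.
Proof. by apply/classesP; exists i. Qed.

Lemma classE X i : X \in classes -> i \in X -> X = cls i.
Proof.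
by move=> /classesP[j ->]; rewrite inE => eji; apply/eqP; rewrite eq_cls.
Qed.

Lemma partition_classes : finset.partition classes [set: 'I_n].
Proof.
apply: equivalence_partitionP => i j k _ _ _.
by have [? ?] := e_equiv i j k.
Qed.

(** The indicator word of a class, in rescaled coordinates. *)
Definition class_vec i := of_coords (fun j => (e i j)%:R).

Lemma class_vec_constant i : class_constant (class_vec i).
Proof.
by move=> j k ejk; rewrite !of_coordsK equiv_sym (equiv_left ejk) equiv_sym.
Qed.

Definition full_classes := [set X in classes | #|X| == q]%SET.

Definition class_sums v : 'rV[F]_#|full_classes| :=
  \row_(t < #|full_classes|) \sum_(i in (enum_val t : {set 'I_n})) coordf i v.

Fact class_sums_is_linear : linear class_sums.
Proof.
move=> a u v; apply/rowP=> t; rewrite !mxE big_distrr -big_split /=.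
by apply: eq_bigr => i _; rewrite linearP.
Qed.

HB.instance Definition _ :=
  GRing.isLinear.Build F 'rV[F]_n 'rV[F]_#|full_classes| _ class_sums
    class_sums_is_linear.

Definition zero_sums : {vspace 'rV[F]_n} := lker (linfun class_sums).

Lemma mem_zero_sums v :
  reflect (forall X, X \in full_classes -> \sum_(i in X) coordf i v = 0)
          (v \in zero_sums).
Proof.
rewrite memv_ker lfunE /=; apply: (iffP eqP) => [/rowP sum0 X fX|sum0].
  by have := sum0 (enum_rank_in fX X); rewrite !mxE enum_rankK_in.
by apply/rowP=> t; rewrite !mxE sum0 ?enum_valP.
Qed.

(** [class_sums] is onto: put each prescribed sum on one representative of its full class and zero
    elsewhere. *)
Lemma dim_zero_sums : (\dim zero_sums + #|full_classes|)%N = n.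
Proof.
have /eqP img : limg (linfun class_sums) == fullv.
  rewrite eqEsubv subvf; apply/subvP=> r _.
  have rep X : X \in full_classes -> exists i, i \in X.
    by rewrite inE => /andP[/classesP[i ->] _]; exists i;
      rewrite inE equiv_refl.
  pose rp t := xchoose (rep _ (enum_valP t)).
  have rpP t : rp t \in enum_val t by apply: xchooseP.
  pose v := of_coords (fun i => \sum_t r 0 t * (i == rp t)%:R).
  apply/memv_imgP; exists v; rewrite ?memvf // lfunE /=; apply/rowP=> s.
  rewrite mxE (eq_bigr _ (fun i _ => of_coordsK _ i)) exchange_big /=.
  rewrite (bigD1 s) //= (bigD1 (rp s)) //= eqxx mulr1 big1 => [|i /andP[_
    /negPf->]]; last by rewrite mulr0.
  rewrite addr0 big1 ?addr0 // => t ts; rewrite big1 // => i iX.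
  case: eqVneq => [irt|_]; last by rewrite mulr0.
  case/eqP: ts; apply: enum_val_inj.
  have /setIdP[Ct _] := enum_valP t; have /setIdP[Cs _] := enum_valP s.
  by rewrite (classE Ct (rpP t)) (classE Cs iX) irt.
have := limg_ker_dim (linfun class_sums) fullv.
by rewrite capfv img !dimvf /dim /= !mul1n.
Qed.


(** * Good words and their span *)

Lemma card_cls_good g i : good g -> (#|cls i| <= q)%N.
Proof.
move=> /goodP gg; rewrite -(card_in_imset (f := coordf^~ g)) ?max_card //.
move=> j k; rewrite !inE => eij eik gjk; apply/eqP; apply: contraT => jk.
have := gg j k jk; rewrite -(equiv_left eij) eik => /(_ isT).
by rewrite gjk eqxx.
Qed.

Lemma good_ex : (forall i, (#|cls i| <= q)%N) -> exists g, good g.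
Proof.
(* Each member of a class receives the field element with the same position in [enum F]. Classes
   have at most [q] members, so the default 0 is never reached. *)
move=> le_q; pose x j := nth 0 (enum F) (index j (enum (cls j))).
exists (of_coords x); apply/goodP => i j ij eij; rewrite !of_coordsK /x.
have /eqP clsij : cls i == cls j by rewrite eq_cls.
have lt_q k : k \in cls j -> (index k (enum (cls j)) < size (enum F))%N.
  by move=> kj;
    rewrite -cardE (leq_trans _ (le_q j)) // cardE index_mem mem_enum.
have jj : j \in cls j by rewrite inE equiv_refl.
have ij' : i \in cls j by rewrite inE equiv_sym.
rewrite clsij nth_uniq ?enum_uniq ?lt_q //.
apply: contraNneq ij => eq_idx; apply/eqP.
by rewrite -[i](nth_index i (s := enum (cls j))) ?mem_enum // eq_idx nth_index
  ?mem_enum.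
Qed.

(** On a class of [q] elements a good word takes every value of [F] exactly once. *)
Lemma sum_full_class g X : good g -> X \in full_classes ->
  \sum_(i in X) coordf i g = \sum_(a : F) a.
Proof.
move=> /goodP gg; rewrite inE => /andP[CX /eqP cardX].
have inj : {in X &, injective (coordf^~ g)}.
  move=> j k jX kX gjk; apply/eqP; apply: contraT => jk.
  have := gg j k jk; rewrite gjk eqxx; apply.
  by rewrite -eq_cls -(classE CX jX) -(classE CX kX).
rewrite -(big_imset (h := coordf^~ g) id inj); apply: eq_bigl => a.
have /setP/(_ a) : coordf^~ g @: X = [set: F]%SET; last by rewrite inE.
by apply/eqP;
  rewrite eqEcard finset.subsetT cardsT card_in_imset // cardX leqnn.
Qed.

Lemma class_constant_zero_sums u : class_constant u -> u \in zero_sums.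
Proof.
move=> cu; apply/mem_zero_sums => X; rewrite inE => /andP[CX /eqP cardX].
have [i iX] : exists i, i \in X.
  by case/classesP: CX => i ->; exists i; rewrite inE equiv_refl.
rewrite (eq_bigr (fun=> coordf i u)) => [|j jX]; last first.
  by apply: cu; rewrite -eq_cls -(classE CX jX) -(classE CX iX).
(* Translation by the constant value permutes [F], so [q] times that value is zero. *)
have : \sum_(a : F) a = \sum_(a : F) (a + coordf i u).
  exact: reindex_inj (addIr (coordf i u : F)).
rewrite big_split /= -[LHS]addr0 => /addrI /esym.
by rewrite !sumr_const cardX.
Qed.

Lemma repr_coords v : v = \sum_i (coordf i v : F) *: of_coords (fun j => (j ==
  i)%:R).
Proof.
apply: coordf_inj => j;
  rewrite linear_sum /= (bigD1 j) //= linearZ /= of_coordsK.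
rewrite eqxx /GRing.scale /= mulr1 big1 ?addr0 // => i ij.
by rewrite linearZ /= of_coordsK eq_sym (negPf ij) /GRing.scale /= mulr0.
Qed.

(** A class that is not full misses some value [a]. Giving [a] to the coordinate [i] of [g] yields
    another good word, which differs from [g] in that coordinate alone. *)
Lemma delta_in_span g i : good g -> (#|cls i| < q)%N ->
  of_coords (fun j => (j == i)%:R) \in good_span.
Proof.
move=> gg ltq; set d := of_coords _.
have [a aX] : exists a, a \notin [set coordf j g | j in cls i]%SET.
  apply/existsP; rewrite -negb_forall; apply: contraL ltq => /forallP all.
  rewrite -leqNgt -cardsT; apply: leq_trans (leq_imset_card (coordf^~ g) _).
  by apply/subset_leq_card/fintype.subsetP => b _; apply: all.
pose c := a - coordf i g.
have c0 : c != 0.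
  rewrite subr_eq0; apply: contraNneq aX => ->; apply: imset_f.
  by rewrite inE equiv_refl.
have gd : good (g + c *: d).
  apply/goodP => j k jk ejk; rewrite !linearD !linearZ /= !of_coordsK.
  have nX l : e i l -> coordf l g != a.
    by move=> eil; apply: contraNneq aX => <-; apply: imset_f; rewrite inE.
  have gjk := goodP _ gg j k jk ejk.
  case: (eqVneq j i) (eqVneq k i) => [ji|ji] [ki|ki];
    rewrite /GRing.scale /= ?mulr1 ?mulr0 ?addr0 //.
  - by rewrite ji ki eqxx in jk.
  - by rewrite ji /c addrC subrK eq_sym nX // -ji.
  - by rewrite ki /c [X in _ != X]addrC subrK nX // equiv_sym -ki.
have -> : d = c^-1 *: ((g + c *: d) - g).
  by rewrite [g + _]addrC addrK scalerA mulVf ?scale1r.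
by rewrite memvZ // memvB ?good_in_span.
Qed.

(** Exchanging the values of [g] at [i] and [j] yields a good word, and the difference is a multiple
    of [d]. *)
Lemma delta_diff_in_span g i j : good g -> e i j ->
  of_coords (fun k => (k == i)%:R) - of_coords (fun k => (k == j)%:R)
    \in good_span.
Proof.
move=> gg eij; have [->|ij] := eqVneq i j; first by rewrite subrr mem0v.
set d := _ - _; pose c := coordf j g - coordf i g.
have c0 : c != 0 by rewrite subr_eq0 eq_sym (goodP _ gg).
have swapE k : coordf k (g + c *: d) = coordf (tperm i j k) g.
  rewrite linearD linearZ linearB /= !of_coordsK /GRing.scale /=.
  case: tpermP => [->|->|/eqP/negPf-> /eqP/negPf->].
  - by rewrite eqxx (negPf ij) subr0 mulr1 addrC subrK.
  - by rewrite eqxx [j == i]eq_sym (negPf ij) sub0r mulrN1 opprB addrC subrK.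
  - by rewrite subr0 mulr0 addr0.
have swap_e k : e k =1 e (tperm i j k).
  by case: tpermP => [->|->|_ _] //; apply: equiv_left; rewrite // equiv_sym.
have gd : good (g + c *: d).
  apply/goodP => k l kl ekl; rewrite !swapE (goodP _ gg) ?(inj_eq perm_inj) //.
  by rewrite -swap_e equiv_sym -swap_e equiv_sym.
have -> : d = c^-1 *: ((g + c *: d) - g).
  by rewrite [g + _]addrC addrK scalerA mulVf ?scale1r.
by rewrite memvZ // memvB ?good_in_span.
Qed.

(** Class by class: single coordinates are available on classes that are not full; on a full class
    the zero sum allows rewriting in differences to one representative. *)
Lemma zero_sums_sub g : good g -> (zero_sums <= good_span)%VS.
Proof.
move=> gg; apply/subvP => v /mem_zero_sums v0; rewrite [v]repr_coords.
rewrite (eq_bigl (fun i => i \in [set: 'I_n]%SET)) => [|i];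
  last by rewrite finset.in_setT.
rewrite (set_partition_big _ partition_classes).
apply: memv_suml => X CX; have [i iX] : exists i, i \in X.
  by case/classesP: CX => i ->; exists i; rewrite inE equiv_refl.
have := card_cls_good i gg; rewrite -(classE CX iX) leq_eqVlt.
case/predU1P => [fX|ltq]; last first.
  by apply: memv_suml => j jX;
    rewrite memvZ // (delta_in_span gg) // -(classE CX jX).
have vX0 : \sum_(j in X) (coordf j v : F) = 0 by rewrite v0 // inE CX fX eqxx.
pose d j := of_coords (fun k => (k == j)%:R).
have -> : \sum_(j in X) (coordf j v : F) *: d j
        = \sum_(j in X) (coordf j v : F) *: (d j - d i).
  under [RHS]eq_bigr do rewrite scalerBr.
  by rewrite sumrB -scaler_suml vX0 scale0r subr0.
apply: memv_suml => j jX; rewrite memvZ // (delta_diff_in_span gg) //.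
by rewrite -eq_cls -(classE CX jX) -(classE CX iX).
Qed.

(** Two good words have the same sum on every full class, so they differ by an element of
    [zero_sums]. *)
Lemma good_span_sub g : good g -> (good_span <= zero_sums + <[g]>)%VS.
Proof.
move=> gg; apply/span_subvP=> h; rewrite mem_enum => gh.
rewrite -(subrK g h) memv_add ?memv_line //; apply/mem_zero_sums => X fX.
rewrite (eq_bigr (fun i => coordf i h - coordf i g)) => [|i _];
  last exact: linearB.
by rewrite sumrB !sum_full_class // subrr.
Qed.

End ScaledCoordinates.

(** * The sum of all elements of a finite field *)

Lemma sum_field_gt2 (F : finFieldType) : (2 < #|F|)%N -> \sum_(a : F) a = 0.
Proof.
move=> q2; have [c] : exists c, c \notin [set (0 : F); 1]%SET.
  apply/existsP; rewrite -negb_forall; apply: contraL q2 => /forallP all.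
  have /subset_leq_card : [set: F]%SET \subset [set (0 : F); 1]%SET.
    by apply/fintype.subsetP=> a _; apply: all.
  by rewrite cardsT cards2 eq_sym oner_neq0 -leqNgt.
rewrite !inE negb_or => /andP[c0 c1].
(* Multiplication by [c], which is neither 0 nor 1, permutes [F] and so fixes the sum. *)
have : \sum_(a : F) a = \sum_(a : F) c * a by exact: reindex_inj (mulfI c0).
rewrite -big_distrr /= -[LHS]mul1r => /eqP; rewrite -subr_eq0 -mulrBl mulf_eq0.
by rewrite subr_eq0 eq_sym (negPf c1) => /eqP.
Qed.

Lemma two_element_field_eq1 (F : finFieldType) (a : F) :
  #|F| = 2%N -> a != 0 -> a = 1.
Proof.
move=> q2 a0; have : a \in [set: F]%SET by [].
have /eqP <- : [set (0 : F); 1]%SET == [set: F]%SET.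
  by rewrite eqEcard finset.subsetT cardsT q2 cards2 eq_sym oner_neq0.
by rewrite !inE (negPf a0) => /eqP.
Qed.

Lemma sum_field_eq2 (F : finFieldType) : #|F| = 2%N -> \sum_(a : F) a != 0.
Proof.
move=> q2; rewrite (bigD1 0) //= (bigD1 1) ?oner_neq0 //= big_pred0.
  by rewrite add0r addr0 oner_neq0.
move=> a; have [//|a0] := eqVneq a 0.
by rewrite (two_element_field_eq1 q2 a0) eqxx.
Qed.

(** * Counting coordinates by the sizes of their classes *)

Section ClassCounts.
Variables (F : finFieldType) (n : nat) (e : rel 'I_n).
Hypothesis e_equiv : equivalence_rel e.

Local Notation q := #|F|.
Local Notation P := (classes e).
Local Notation Q := (full_classes F e).

Definition repeated_classes := [set X in P | (1 < #|X|)%N]%SET.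
Local Notation L := repeated_classes.

Lemma sum_card_classes : (\sum_(X in P) #|X| = n)%N.
Proof.
by rewrite -(card_partition (partition_classes e_equiv)) cardsT card_ord.
Qed.

(** Turns the counts into a sum of weights over classes, so that the next two bounds can be compared
    one class at a time. *)
Lemma sum_class_weights a b : (\sum_(X in P) (1 + a * (X \in L) + b * (X \in
  Q)) =
  #|P| + a * #|L| + b * #|Q|)%N.
Proof.
rewrite !big_split /= -!big_distrr /= sum1_card; congr (_ + _ * _ + _ * _)%N.
  rewrite -sum1_card big_mkcond [RHS]big_mkcond /=; apply: eq_bigr => X _.
  by rewrite inE; case: (X \in P); case: (1 < #|X|)%N.
rewrite -sum1_card big_mkcond [RHS]big_mkcond /=; apply: eq_bigr => X _.
by rewrite inE; case: (X \in P); case: (#|X| == q).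
Qed.

Lemma card_class_gt0 X : X \in P -> (0 < #|X|)%N.
Proof.
by case/(classesP e _)=> i ->; apply/card_gt0P; exists i;
  rewrite inE equiv_refl.
Qed.

(** A class has at least one element, a repeated one at least 2, a full one [q = 2 + (q - 2)]. *)
Lemma card_coords_ge : (#|P| + #|L| + (q - 2) * #|Q| <= n)%N.
Proof.
rewrite -[X in (_ <= X)%N]sum_card_classes -[#|L|]mul1n -sum_class_weights.
apply: leq_sum => X PX; have := card_class_gt0 PX; rewrite !inE PX /=.
by have := card_finNzRing_gt1 F; case: (ltnP 1 #|X|); case: (#|X| =P q);
  rewrite /= ?muln1 ?muln0; lia.
Qed.

(** A repeated class that is not full has at most [q - 1 = 1 + (q - 2)] elements, a full one has one
    more. *)
Lemma card_coords_le : (forall i, #|cls e i| <= q)%N ->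
  (n <= #|P| + (q - 2) * #|L| + #|Q|)%N.
Proof.
move=> le_q;
  rewrite -[X in (X <= _)%N]sum_card_classes -[#|Q|]mul1n -sum_class_weights.
apply: leq_sum => X PX; have : (#|X| <= q)%N.
  by case/(classesP e _): PX => i ->.
have := card_class_gt0 PX; rewrite !inE PX /=.
by have := card_finNzRing_gt1 F; case: (ltnP 1 #|X|); case: (#|X| =P q);
  rewrite /= ?muln1 ?muln0; lia.
Qed.

Lemma card_full_repeated : (#|Q| <= #|L|)%N.
Proof.
apply/subset_leq_card/fintype.subsetP=> X; rewrite !inE => /andP[-> /eqP->].
exact: card_finNzRing_gt1.
Qed.

End ClassCounts.

(** [l] stands for the number of column classes and [m] for the number of repeated ones. *)
Definition star_condition (q k n l m : nat) : Prop :=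
  [\/ q = 2%N /\ ([/\ l = k, k = 3%N & n = 6%N] \/ (k.+1 <= l)%N),
      q = 3%N /\ [\/ l = k.-1 /\ (3 <= m)%N, l = k /\ (2 <= m)%N | (k.+1 <=
        l)%N],
      q = 4%N /\ [\/ l = k.-1 /\ k.-1 = 1%N, l = k.-1 /\ (2 <= m)%N | (k <=
        l)%N]
    | (5 <= q)%N].

(** * Codes above a non-projective code *)

Section StarOfCode.
Variables (F : finFieldType) (n k : nat) (lam : 'I_n -> F) (e : rel 'I_n).
Variable S : {vspace 'rV[F]_n}.
Hypotheses (lam_neq0 : forall i, lam i != 0) (e_equiv : equivalence_rel e).
Hypotheses (n_gt1 : (1 < n)%N) (k_gt0 : (0 < k)%N) (dimS : \dim S = k.-1).
Hypothesis S_constant : forall s, s \in S -> class_constant lam e s.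
Hypothesis S_separated : forall i j b, ~~ e i j ->
  exists2 s, s \in S & coordf lam i s != b * coordf lam j s.
Hypothesis S_neq0 : forall i, exists2 s, s \in S & coordf lam i s != 0.
Hypothesis e_nontrivial : exists i j, (i != j) && e i j.

Local Notation q := #|F|.
Local Notation x_ := (coordf lam).
Local Notation good := (good lam e).
Local Notation good_span := (good_span lam e).
Local Notation class_vec := (class_vec lam e).

Lemma good_notin g : good g -> g \notin S.
Proof.
move=> /goodP gg; apply/negP => /S_constant gS.
by have [i [j /andP[ij eij]]] := e_nontrivial; have := gg i j ij eij;
  rewrite (gS i j eij) eqxx.
Qed.

(** [S] separates inequivalent coordinates. Equivalent ones are separated by [g] if [b = 1], and
    otherwise by any word of [S] that is nonzero there. *)
Lemma good_above g : good g -> codes_above k S (S + <[g]>)%VS.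
Proof.
move=> gg; split; last exact: addvSl; split.
  rewrite dimv_disjoint_sum ?dimS ?dim_vline.
    suff -> : g != 0 by rewrite addn1 prednK.
    by apply: contraNneq (good_notin gg) => ->; rewrite mem0v.
  apply/eqP; rewrite -subv0; apply/subvP=> w /memv_capP[cS /vlineP[c wc]].
  rewrite memv0 wc scaler_eq0; apply: contraR (good_notin gg).
  rewrite negb_or => /andP[c0 _]; rewrite -[g]scale1r -(mulVf c0) -scalerA.
  by rewrite memvZ // -wc.
apply/(projective_separated lam_neq0) => // i j b ij.
have [eij|eij] := boolP (e i j); last first.
  have [s sS neq] := S_separated b eij; exists s => //.
  by apply: (subvP (addvSl _ _)).
have gsum : g \in (S + <[g]>)%VS by apply: (subvP (addvSr _ _));
  apply: memv_line.
have [b1|b1] := eqVneq b 1.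
  by exists g => //; rewrite b1 mul1r (goodP _ _ _ gg).
have [s sS neq] := S_neq0 i; exists s; first exact: (subvP (addvSl _ _)).
rewrite -(S_constant sS eij) -subr_eq0 -[X in X - _]mul1r -mulrBl mulf_eq0.
by rewrite (negPf neq) orbF subr_eq0 eq_sym.
Qed.

(** Any word [g] of [C] outside [S] works: if [g] agreed at two equivalent coordinates, so would all
    of [S + <[g]>]. *)
Lemma above_good C : codes_above k S C ->
  exists2 g, good g & (C = S + <[g]>)%VS.
Proof.
move=> [[dC pC] SC]; have sepC := (projective_separated lam_neq0 C n_gt1).1 pC.
have /subvPn[g gC gS] : ~~ (C <= S)%VS.
  by apply/negP=> /dimvS; rewrite dC dimS; move: k_gt0; lia.
have CE : C = (S + <[g]>)%VS.
  apply/esym/eqP; rewrite eqEdim subv_add SC -memvE gC dC /= -(prednK k_gt0).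
  rewrite -dimS ltn_neqAle dimvS ?addvSl // andbT.
  apply: contraNneq gS => dE; have /eqP-> : S == (S + <[g]>)%VS.
    by rewrite eqEdim addvSl dE leqnn.
  by apply: (subvP (addvSr _ _)); apply: memv_line.
exists g => //; apply/goodP => i j ij eij; apply/negP=> /eqP gij.
have [v vC] := sepC i j 1 ij; rewrite mul1r.
move: vC; rewrite CE => /memv_addP[s sS [_ /vlineP[c ->] ->]].
by rewrite !linearD !linearZ /= (S_constant sS eij) gij eqxx.
Qed.

Lemma above_ex : (exists C, codes_above k S C) <->
  forall i, (#|cls e i| <= q)%N.
Proof.
split=> [[C /above_good[g gg _]] i|/(good_ex lam_neq0 e_equiv)[g /good_above]].
  exact: card_cls_good gg.
by exists (S + <[g]>)%VS.
Qed.

Lemma code_sub_good_span g : good g -> (S <= good_span)%VS.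
Proof.
move=> gg; apply/subvP=> s /S_constant; exact: class_constant_in_span gg.
Qed.

Lemma above_sub_good_span C : codes_above k S C -> (C <= good_span)%VS.
Proof.
case/above_good=> g gg ->; rewrite subv_add (code_sub_good_span gg) -memvE.
exact: good_in_span.
Qed.

(** * Blockers and functionals on a space containing the good words *)

Lemma star_blocker_good_span g D : good g -> star_blocker k S D ->
  (good_span <= S + D)%VS /\ \dim (S + D) = k.+1.
Proof.
move=> gg bD; split;
  last by have [] := star_blocker_span k_gt0 dimS bD (good_above gg).
apply/span_subvP => h; rewrite mem_enum => gh.
have [/subvP sub _] := star_blocker_span k_gt0 dimS bD (good_above gh).
by apply/sub/(subvP (addvSr _ _))/memv_line.
Qed.

Lemma star_of_large_span g : good g -> (k.+1 < \dim good_span)%N ->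
  is_star k (codes_above k S).
Proof.
move=> gg dE; apply/(is_star_blocker k_gt0 dimS); split.
  by exists (S + <[g]>)%VS; apply: good_above.
by case=> D /(star_blocker_good_span gg)[/dimvS sub dD]; move: dE;
  rewrite -dD ltnNge sub.
Qed.

(** The blocker is the kernel of [phi] in [E]. If it is not projective, some [x_ i - b * x_ j]
    vanishes on it and is therefore a multiple of [phi] on [E]. *)
Lemma not_star_of_functional E (phi : 'Hom('rV[F]_n, F^o)) g s : good g ->
    (good_span <= E)%VS -> \dim E = k.+1 -> s \in S -> phi s != 0 ->
    (forall i j b c, i != j -> c != 0 ->
      ~ {in E, forall w, x_ i w - b * x_ j w = c * phi w}) ->
  ~ is_star k (codes_above k S).
Proof.
move=> gg gE dE sS phis nofact /(is_star_blocker k_gt0 dimS)[_]; apply.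
have sE : s \in E by apply/(subvP gE)/(subvP (code_sub_good_span gg)).
exists (E :&: lker phi)%VS;
  apply: (star_blocker_hyperplane k_gt0 dimS (E := E)).
- by move=> C /above_sub_good_span/subv_trans; apply.
- exact: dE.
- exact: capvSl.
- split; first by apply/eq_add_S; rewrite (dim_cap_lker sE phis).
  apply/(projective_separated lam_neq0) => // i j b ij; apply: contrapT => no.
  pose f := x_ i - b *: x_ j.
  have fE w : f w = x_ i w - b * x_ j w by rewrite add_lfunE opp_lfunE
    scale_lfunE.
  have [|c fc] := functional_factor (f := f) sE phis.
    move=> w wE /eqP phiw; rewrite fE; apply/eqP; rewrite subr_eq0.
    by apply: contrapT => /negP neq; apply: no; exists w;
      rewrite // memv_cap wE memv_ker.
  have [c0|c0] := eqVneq c 0; last first.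
    by apply: (nofact i j b c ij c0) => w wE; rewrite -fE fc.
  (* With [c = 0] the relation between two coordinates would hold on all of [E], hence on the
     projective code [S + <[g]>]. *)
  have [[_ pC] _] := good_above gg.
  have [v vC] := (projective_separated lam_neq0 _ n_gt1).1 pC i j b ij.
  have vE : v \in E by apply/(subvP gE)/(subvP (above_sub_good_span (good_above
    gg))).
  by rewrite -subr_eq0 -fE fc // c0 mul0r eqxx.
- apply/subvPn; exists s => //; by rewrite memv_cap memv_ker (negPf phis) andbF.
Qed.

Lemma class_vec_in_span g i : good g -> class_vec i \in good_span.
Proof.
by move=> gg; apply: class_constant_in_span gg _ => //;
  apply: class_vec_constant.
Qed.

Lemma coordf_class_vec i j : x_ j (class_vec i) = (e i j)%:R.
Proof. by rewrite of_coordsK. Qed.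

(** The sum of three coordinates is nonzero on three class vectors, while a combination of two
    coordinates can be nonzero on at most two. *)
Lemma not_star_of_three_classes E g s i1 i2 i3 : good g ->
    (good_span <= E)%VS -> \dim E = k.+1 -> s \in S ->
    [/\ ~~ e i1 i2, ~~ e i1 i3 & ~~ e i2 i3] ->
    x_ i1 s + x_ i2 s + x_ i3 s != 0 ->
  ~ is_star k (codes_above k S).
Proof.
move=> gg gE dE sS [n12 n13 n23] sneq.
pose phi := x_ i1 + x_ i2 + x_ i3.
have phiE w : phi w = x_ i1 w + x_ i2 w + x_ i3 w by rewrite !add_lfunE.
apply: (@not_star_of_functional E phi g s) => //; first by rewrite phiE.
move=> i j b c ij c0 fc.
have hit l : phi (class_vec l) != 0 -> e l i || e l j.
  apply: contraR; rewrite negb_or => /andP[/negPf li /negPf lj].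
  have := fc (class_vec l);
    rewrite (subvP gE) ?(class_vec_in_span _ gg) // => /(_ isT).
  rewrite !coordf_class_vec li lj mulr0 subrr => /esym/eqP.
  by rewrite mulf_eq0 (negPf c0).
have := (hit i1, hit i2, hit i3); rewrite !phiE !coordf_class_vec.
have es := equiv_sym e_equiv; rewrite !(equiv_refl e_equiv).
rewrite (es i2 i1) (es i3 i1) (es i3 i2).
rewrite (negPf n12) (negPf n13) (negPf n23) !addr0 !add0r !oner_neq0.
move=> [[/(_ isT) h1 /(_ isT) h2] /(_ isT) h3].
have tr l a b' : e a l -> e b' l -> e a b'.
  by move=> al bl; rewrite (equiv_left e_equiv al) es.
case/orP: h1 => h1; case/orP: h2 => h2; case/orP: h3 => h3;
  by move: n12 n13 n23;
    rewrite ?(tr _ _ _ h1 h2) ?(tr _ _ _ h1 h3) ?(tr _ _ _ h2 h3).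
Qed.

(** On class vectors [phi] sees only the class of [b0]. A combination of two coordinates
    proportional to [phi] therefore involves this class alone and vanishes on [v], whereas [phi v]
    is nonzero. *)
Lemma not_star_of_twisted_pair g v a1 a2 b0 : good g ->
    \dim good_span = k.+1 -> v \in good_span ->
    e a1 a2 -> ~~ e a1 b0 -> (forall i, e b0 i -> x_ i v = 0) ->
    x_ a1 v != x_ a2 v ->
  ~ is_star k (codes_above k S).
Proof.
move=> gg dE vE ea nab vb va; have [s sS sneq] := S_neq0 b0.
pose phi := x_ a1 - x_ a2 + x_ b0.
have phiE w : phi w = x_ a1 w - x_ a2 w + x_ b0 w.
  by rewrite !add_lfunE opp_lfunE.
have es := equiv_sym e_equiv.
have phic l : phi (class_vec l) = (e l b0)%:R.
  rewrite phiE !coordf_class_vec (es l a1) (es l a2).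
  by rewrite (equiv_left e_equiv ea) subrr add0r.
apply: (@not_star_of_functional good_span phi g s) => //.
  by rewrite phiE (S_constant sS ea) subrr add0r.
move=> i j b c ij c0 fc.
have fcl l : (e l i)%:R - b * (e l j)%:R = c * (e l b0)%:R.
  by rewrite -phic -fc ?(class_vec_in_span _ gg) // !coordf_class_vec.
have phiv : x_ i v - b * x_ j v != 0.
  by rewrite fc // mulf_neq0 // phiE (vb b0) ?(equiv_refl e_equiv) // addr0
    subr_eq0.
have [eij|neij] := boolP (e j i).
  have := fcl b0;
    rewrite (equiv_refl e_equiv) (es b0 i) (es b0 j) (equiv_left e_equiv eij).
  have [ib|_] := boolP (e i b0); last first.
    by rewrite /= mulr0 subrr mulr1 => /eqP; rewrite eq_sym (negPf c0).
  move: phiv;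
    rewrite !vb ?mulr0 ?subrr ?eqxx // es ?(equiv_left e_equiv eij) //.
have [ib|nib] := boolP (e b0 i); last first.
  have := fcl i;
    rewrite (equiv_refl e_equiv) (es i b0) (negPf nib) es (negPf neij).
  by rewrite !mulr0 subr0 => /eqP; rewrite oner_eq0.
have := fcl j; rewrite (es j b0) (equiv_left e_equiv ib) (es i j) (negPf neij).
rewrite (equiv_refl e_equiv) mulr1 mulr0 sub0r => /eqP;
  rewrite oppr_eq0 => /eqP b00.
by move: phiv; rewrite b00 mul0r subr0 vb // eqxx.
Qed.


(** * The dimension of the span, and the cliques that are not maximal *)

Local Notation P := (classes e).
Local Notation Q := (full_classes F e).
Local Notation L := (repeated_classes e).
Local Notation Z := (zero_sums lam e).

Lemma class_transversal :
  exists r : 'I_#|P| -> 'I_n, forall s t, e (r s) (r t) = (s == t).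
Proof.
have rep (t : 'I_#|P|) : exists i, i \in enum_val t.
  by have /classesP[i ->] := enum_valP t; exists i; rewrite inE equiv_refl.
have rP t : enum_val t = cls e (xchoose (rep t)).
  exact: classE e_equiv _ _ (enum_valP t) (xchooseP (rep t)).
exists (fun t => xchoose (rep t)) => s t.
by rewrite -(eq_cls e_equiv) -!rP (inj_eq enum_val_inj).
Qed.

Lemma transversal_onto (r : 'I_#|P| -> 'I_n) i :
  (forall s t, e (r s) (r t) = (s == t)) -> exists t, e (r t) i.
Proof.
move=> rE; have inj : injective (cls e \o r).
  by move=> s t /eqP; rewrite /= eq_cls // rE => /eqP.
have /setP/(_ (cls e i)) : (cls e \o r) @: 'I_#|P| = P.
  have cardI : #|(cls e \o r) @: 'I_#|P| | = #|P|.
    by apply: etrans (card_imset _ inj) (card_ord _).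
  apply/eqP; rewrite eqEcard [X in _ && (_ <= X)%N]cardI leqnn andbT.
  by apply/fintype.subsetP=> _ /imsetP[t _ ->]; apply: cls_class.
rewrite cls_class => /imsetP[t _ /eqP]; rewrite eq_cls // (equiv_sym e_equiv).
by exists t.
Qed.

(** Words of [S] are constant on classes, hence combinations of the class vectors. *)
Lemma dim_code_le : (\dim S <= #|P|)%N.
Proof.
have [r rE] := class_transversal.
rewrite -[#|P|]card_ord -(size_codom (fun t => class_vec (r t))).
apply: leq_trans (dim_span _); apply/dimvS/subvP => s sS.
have -> : s = \sum_t (x_ (r t) s : F) *: class_vec (r t).
  apply: (coordf_inj lam_neq0) => i; rewrite linear_sum /=.
  have [t rti] := transversal_onto i rE.
  rewrite (bigD1 t) //= linearZ /= coordf_class_vec rti big1 => [|u ut].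
    by rewrite addr0 /GRing.scale /= mulr1 (S_constant sS rti).
  rewrite linearZ /= coordf_class_vec -(rE u t) in ut *.
  rewrite (equiv_sym e_equiv) -(equiv_left e_equiv rti) (equiv_sym e_equiv)
    (negPf ut).
  by rewrite /GRing.scale /= mulr0.
by apply: memv_suml => t _;
  apply/memvZ/memv_span/(codom_f (fun t => class_vec (r t))).
Qed.

Lemma code_sub_zero_sums : (S <= Z)%VS.
Proof. by apply/subvP => s /S_constant; apply: class_constant_zero_sums. Qed.

Lemma good_span_gt2 g : good g -> (2 < q)%N -> good_span = Z.
Proof.
move=> gg q2; apply/eqP;
  rewrite eqEsubv (zero_sums_sub lam_neq0 e_equiv gg) // andbT //.
rewrite (subv_trans (good_span_sub e_equiv gg)) // subv_add subvv -memvE.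
by apply/mem_zero_sums=> X fX;
  rewrite (sum_full_class e_equiv gg) // sum_field_gt2.
Qed.

Lemma exists_full_class : q = 2%N -> (forall i, #|cls e i| <= q)%N ->
  exists i, cls e i \in Q.
Proof.
move=> q2 le_q; have [i [j /andP[ij eij]]] := e_nontrivial; exists i.
by rewrite inE cls_class eqn_leq le_q q2 (card_cls_gt1 e_equiv ij).
Qed.

(** For [q = 2] the class counts give [n = #|P| + #|Q|], whence the dimension of [Z]. A good word
    has nonzero sum on a full class, so it adds exactly one dimension. *)
Lemma dim_good_span_eq2 g : good g -> q = 2%N ->
  \dim Z = #|P| /\ \dim good_span = #|P|.+1.
Proof.
move=> gg q2; have le_q i := card_cls_good e_equiv i gg.
have dZ : \dim Z = #|P|.
  have := card_coords_le e_equiv le_q; have := card_coords_ge F e_equiv.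
  have := card_full_repeated F e; have := dim_zero_sums lam_neq0 e_equiv.
  by rewrite q2 subnn !mul0n !addn0; lia.
split=> //; have gZ : g \notin Z.
  apply/mem_zero_sums => /(_ _ (svalP (cid (exists_full_class q2 le_q)))).
  rewrite (sum_full_class e_equiv gg) ?(svalP (cid (exists_full_class q2
    le_q))) //.
  by apply/eqP/sum_field_eq2.
apply/eqP; rewrite eqn_leq -dZ; apply/andP; split.
  apply: leq_trans (dimvS (good_span_sub e_equiv gg)) _.
  apply: leq_trans (dimv_add_leqif _ _) _; rewrite dim_vline.
  by case: (_ != _); rewrite ?addn1 ?addn0.
rewrite ltn_neqAle dimvS ?(zero_sums_sub lam_neq0 e_equiv gg) // andbT;
  apply: contraNneq gZ => dE.
have /eqP -> : Z == good_span by rewrite eqEdim (zero_sums_sub lam_neq0 e_equiv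
  gg) // dE leqnn.
exact: good_in_span.
Qed.

Lemma not_star_gt2 g : good g -> (2 < q)%N -> \dim good_span = k.+1 ->
  (1 < #|P|)%N -> ~ is_star k (codes_above k S).
Proof.
move=> gg q2 dE P2; have [a1 [a2 /andP[a12 ea]]] := e_nontrivial.
have [b0 nab] : exists b0, ~~ e a1 b0.
  have [r rE] := class_transversal.
  pose t0 := Ordinal (ltnW P2); pose t1 := Ordinal P2.
  have [ea0|] := boolP (e a1 (r t0)); last by exists (r t0).
  by exists (r t1); rewrite (equiv_left e_equiv ea0) rE.
(* The restriction of [g] to one class. Since [q > 2], [g] has zero sum on every full class, and the
   restriction keeps this property. *)
pose v := of_coords lam (fun i => if e a1 i then x_ i g else 0).
have vE i : x_ i v = if e a1 i then x_ i g else 0 by rewrite of_coordsK.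
apply: (@not_star_of_twisted_pair g v a1 a2 b0) => //.
- move: (good_in_span gg); rewrite (good_span_gt2 gg q2).
  move=> /mem_zero_sums g0; apply/mem_zero_sums=> X fX.
  have /setIdP[/classesP[i Xi] _] := fX.
  rewrite (eq_bigr (fun j => if e a1 i then x_ j g else 0)) => [|j]; last first.
    rewrite Xi inE vE (equiv_sym e_equiv a1) (equiv_sym e_equiv a1 i) => eij.
    by rewrite (equiv_left e_equiv eij).
  by case: (e a1 i); rewrite ?g0 // big1.
- move=> i b0i;
    rewrite vE (equiv_sym e_equiv) -(equiv_left e_equiv b0i) (equiv_sym
    e_equiv).
  by rewrite (negPf nab).
- by rewrite !vE (equiv_refl e_equiv) ea (goodP _ _ _ gg).
Qed.

Lemma not_star_singleton_class g b0 : good g -> \dim good_span = k.+1 ->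
  (forall i, e b0 i -> i = b0) -> ~ is_star k (codes_above k S).
Proof.
move=> gg dE sb; have [a1 [a2 /andP[a12 ea]]] := e_nontrivial.
have nab : ~~ e a1 b0.
  apply: contra_neqN a12 => eab.
  have -> : a1 = b0 by apply: sb; rewrite (equiv_sym e_equiv).
  by apply/esym/sb; rewrite -(equiv_left e_equiv eab).
(* Subtracting this class vector clears the coordinate [b0] and leaves the values at [a1] and [a2]
   unchanged. *)
pose v := g - (x_ b0 g : F) *: class_vec b0.
have vE i : x_ i v = x_ i g - x_ b0 g * (e b0 i)%:R.
  by rewrite linearB linearZ /= coordf_class_vec.
apply: (@not_star_of_twisted_pair g v a1 a2 b0) => //.
- apply: memvB; first exact: good_in_span.
  by apply/memvZ/(class_vec_in_span _ gg).
- by move=> i /[dup] b0i /sb ->; rewrite vE (equiv_refl e_equiv) mulr1 subrr.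
- rewrite !vE (equiv_sym e_equiv b0 a1) (equiv_sym e_equiv b0 a2).
  rewrite -(equiv_left e_equiv ea) (negPf nab) !mulr0 !subr0.
  exact: (goodP _ _ _ gg).
Qed.

(** Here [S = Z] and the good words span only [k] dimensions. An arbitrary further word [w]
    completes the ambient space, and a class vector in [S] serves as witness for three
    coordinates. *)
Lemma not_star_binary_full g : good g -> q = 2%N -> #|P| = k.-1 ->
  (k.+1 < n)%N -> ~ is_star k (codes_above k S).
Proof.
move=> gg q2 Pk kn; have [dZ dE] := dim_good_span_eq2 gg q2.
have le_q i := card_cls_good e_equiv i gg.
(* [n <= #|P| + #|Q| <= 2 * k.-1] and [k.+1 < n] force [k >= 4]. *)
have P3 : (2 < #|P|)%N.
  have := card_coords_le e_equiv le_q; have := dim_zero_sums lam_neq0 e_equiv.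
  have : (#|Q| <= #|P|)%N.
    by apply/subset_leq_card/fintype.subsetP=> X /setIdP[].
  by rewrite q2 subnn mul0n addn0; move: k_gt0; lia.
have [r rE] := class_transversal.
pose i1 := r (Ordinal (ltnW (ltnW P3))); pose i2 := r (Ordinal (ltnW P3)).
pose i3 := r (Ordinal P3).
have SZ : S = Z by apply/eqP;
  rewrite eqEdim code_sub_zero_sums dZ dimS Pk leqnn.
have [w wE] : exists w, w \notin good_span.
  apply/existsP; rewrite -negb_forall; apply: contraL kn => /forallP all.
  have /eqP : good_span == fullv by rewrite eqEsubv subvf; apply/subvP.
  move/(congr1 (fun U => \dim U)); rewrite dE dimvf /dim /= mul1n => <-.
  by rewrite Pk prednK // -leqNgt.
apply: (@not_star_of_three_classes (good_span + <[w]>)%VS g (class_vec i1) i1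
  i2 i3) => //.
- exact: addvSl.
- apply/eqP; rewrite eqn_leq; apply/andP; split.
    apply: leq_trans (dimv_add_leqif _ _) _; rewrite dE Pk prednK // dim_vline.
    by case: (_ != _); rewrite ?addn1 ?addn0.
  rewrite -[k](prednK k_gt0) -Pk -dE ltn_neqAle dimvS ?addvSl // andbT.
  apply: contraNneq wE => dEw;
    have /eqP-> : good_span == (good_span + <[w]>)%VS.
    by rewrite eqEdim addvSl dEw leqnn.
  by apply: (subvP (addvSr _ _)); apply: memv_line.
- by rewrite SZ class_constant_zero_sums //; apply: class_vec_constant.
- by rewrite !rE.
- by rewrite !coordf_class_vec !rE !addr0 oner_neq0.
Qed.

(** Two triples sharing [i1] and [i2] suffice: a word of [S] with different values at [i3] and [i4]
    has nonzero sum on one of them. *)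
Lemma not_star_binary_doubled g : good g -> q = 2%N -> #|P| = k -> (3 < k)%N ->
  ~ is_star k (codes_above k S).
Proof.
move=> gg q2 Pk k4; have [_ dE] := dim_good_span_eq2 gg q2.
have [r rE] := class_transversal; have P4 : (3 < #|P|)%N by rewrite Pk.
pose i1 := r (Ordinal (ltnW (ltnW (ltnW P4)))).
pose i2 := r (Ordinal (ltnW (ltnW P4))); pose i3 := r (Ordinal (ltnW P4)).
pose i4 := r (Ordinal P4); have n34 : ~~ e i3 i4 by rewrite rE.
have [s sS] := S_separated 1 n34; rewrite mul1r => s34.
have [s0|s0] := eqVneq (x_ i1 s + x_ i2 s + x_ i3 s) 0; last first.
  by apply: (@not_star_of_three_classes good_span g s i1 i2 i3);
    rewrite ?rE ?dE ?Pk ?subvv.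
apply: (@not_star_of_three_classes good_span g s i1 i2 i4);
  rewrite ?rE ?dE ?Pk ?subvv //.
by apply: contra_neq s34 => s0'; apply: (addrI (x_ i1 s + x_ i2 s)); rewrite s0.
Qed.

(** * The exceptional binary case: three classes of two columns *)

Lemma star_blocker_functional g D : good g -> \dim good_span = k.+1 ->
  star_blocker k S D ->
  exists phi : 'Hom('rV[F]_n, F^o),
    [/\ forall u, u \in good_span -> (u \in D) = (phi u == 0),
        exists2 s, s \in S & phi s != 0 & separated lam D].
Proof.
move=> gg dE bD; have [sub dSD] := star_blocker_good_span gg bD.
have EE : good_span = (S + D)%VS by apply/eqP; rewrite eqEdim sub dSD dE leqnn.
have [[dD pD] /subvPn[s sS sD] _] := bD.
have [||phi phiE] := @hyperplane_functional _ _ D good_span.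
- by rewrite EE addvSr.
- by rewrite dE dD.
exists phi; split=> //.
  by exists s; rewrite // -phiE ?(subvP (code_sub_good_span gg)).
exact/(projective_separated lam_neq0).
Qed.

Definition class_triple i1 i2 i3 :=
  [/\ ~~ e i1 i2, ~~ e i1 i3, ~~ e i2 i3 & forall i, [|| e i1 i, e i2 i | e i3
    i]].

Lemma class_triple_rot i1 i2 i3 : class_triple i1 i2 i3 -> class_triple i2 i3
  i1.
Proof.
move=> [n12 n13 n23 cov]; split=> // [||i].
- by rewrite (equiv_sym e_equiv).
- by rewrite (equiv_sym e_equiv).
- by have := cov i; case: (e i1 i); case: (e i2 i); case: (e i3 i).
Qed.

Lemma class_triple_swap i1 i2 i3 : class_triple i1 i2 i3 -> class_triple i2 i1
  i3.
Proof.
move=> [n12 n13 n23 cov]; split=> // [|i].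
- by rewrite (equiv_sym e_equiv).
- by have := cov i; case: (e i1 i); case: (e i2 i); case: (e i3 i).
Qed.

Lemma class_triple_ex : #|P| = 3%N -> exists i1 i2 i3, class_triple i1 i2 i3.
Proof.
have [r rE] := class_transversal => P3.
have lt0 : (0 < #|P|)%N by rewrite P3.
have lt1 : (1 < #|P|)%N by rewrite P3.
have lt2 : (2 < #|P|)%N by rewrite P3.
exists (r (Ordinal lt0)), (r (Ordinal lt1)), (r (Ordinal lt2)).
split; rewrite ?rE // => i; have [[t ltt] eti] := transversal_onto i rE.
have := ltt; rewrite {1}P3; case: t ltt eti => [|[|[|//]]] ltt eti _.
- by rewrite (bool_irrelevance lt0 ltt) eti.
- by rewrite (bool_irrelevance lt1 ltt) eti orbT.
- by rewrite (bool_irrelevance lt2 ltt) eti !orbT.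
Qed.

Lemma functional_class_triple i1 i2 i3 (phi : 'Hom('rV[F]_n, F^o)) z :
    class_triple i1 i2 i3 -> class_constant lam e z ->
  phi z = x_ i1 z * phi (class_vec i1) + x_ i2 z * phi (class_vec i2)
        + x_ i3 z * phi (class_vec i3).
Proof.
move=> [n12 n13 n23 cov] cz.
have {1}-> : z = (x_ i1 z : F) *: class_vec i1 + (x_ i2 z : F) *: class_vec i2
            + (x_ i3 z : F) *: class_vec i3.
  apply: (coordf_inj lam_neq0) => i;
    rewrite !linearD !linearZ /= !coordf_class_vec.
  rewrite /GRing.scale /=; case/or3P: (cov i) => eti.
  - rewrite -(cz _ _ eti) eti -!(equiv_sym e_equiv i) -!(equiv_left e_equiv
      eti).
    by rewrite (negPf n12) (negPf n13) !mulr0 !addr0 mulr1.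
  - rewrite -(cz _ _ eti) eti -!(equiv_sym e_equiv i) -!(equiv_left e_equiv
      eti).
    by rewrite (equiv_sym e_equiv) (negPf n12) (negPf n23) !mulr0 addr0 add0r
      mulr1.
  - rewrite -(cz _ _ eti) eti -!(equiv_sym e_equiv i) -!(equiv_left e_equiv
      eti).
    rewrite (equiv_sym e_equiv i3 i1) (equiv_sym e_equiv i3 i2).
    by rewrite (negPf n13) (negPf n23) !mulr0 !add0r mulr1.
by rewrite !linearD !linearZ.
Qed.

(** On a class of two elements a zero sum means equal values, as [-1 = 1]. *)
Lemma binary_zero_sums_constant z : q = 2%N -> (forall i, #|cls e i| <= q)%N ->
  z \in Z -> class_constant lam e z.
Proof.
move=> q2 le_q /mem_zero_sums z0 i j eij.
have [->//|ij] := eqVneq i j.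
have clsE : cls e i = [set i; j]%SET.
  apply/esym/eqP; rewrite eqEcard cards2 ij (leq_trans (le_q i)) ?q2 // andbT.
  by apply/fintype.subsetP=> l; rewrite !inE => /orP[]/eqP->;
    rewrite ?(equiv_refl e_equiv).
have := z0 (cls e i); rewrite inE cls_class clsE cards2 ij q2 => /(_ isT).
rewrite big_setU1 ?inE //= big_set1 => /eqP; rewrite addr_eq0 => /eqP->.
have /(two_element_field_eq1 q2) N1 : - (1 : F) != 0 by rewrite oppr_eq0
  oner_neq0.
by rewrite -mulN1r N1 mul1r.
Qed.

(** Otherwise [psi] would impose on [S] a relation between [x_ i1] and [x_ i2] alone. A nontrivial
    one contradicts separation or nondegeneracy; a trivial one would give [Z <= S]. *)
Lemma code_functional_neq0 i1 i2 i3 (psi : 'Hom('rV[F]_n, F^o)) :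
    class_triple i1 i2 i3 -> (\dim S < \dim Z)%N ->
    (forall z, z \in Z -> class_constant lam e z) ->
    (forall z, z \in Z -> (z \in S) = (psi z == 0)) -> psi (class_vec i3) != 0.
Proof.
move=> tri ltSZ Zc psiE; apply/negP=> /eqP psi3; have [n12 _ _ _] := tri.
have psiz z : class_constant lam e z ->
    psi z = x_ i1 z * psi (class_vec i1) + x_ i2 z * psi (class_vec i2).
  by move=> cz; rewrite (functional_class_triple _ tri cz) psi3 mulr0 addr0.
have psiS s : s \in S -> psi s = 0.
  by move=> sS; apply/eqP; rewrite -psiE // (subvP code_sub_zero_sums).
have [a1|a1] := eqVneq (psi (class_vec i1)) 0; last first.
  have [s sS /eqP] := S_separated (- psi (class_vec i2) / psi (class_vec i1))
    n12.
  apply; apply: (mulIf a1); rewrite mulrAC divfK // mulNr mulrC.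
  apply/eqP; rewrite -addr_eq0 mulrC [psi _ * _]mulrC -psiz ?psiS //.
  exact: S_constant.
have [a2|a2] := eqVneq (psi (class_vec i2)) 0; last first.
  have [s sS] := S_neq0 i2; have := psiz s (S_constant sS).
  by rewrite psiS // a1 mulr0 add0r => /esym/eqP;
    rewrite mulf_eq0 (negPf a2) orbF => ->.
move: ltSZ; rewrite ltnNge => /negP[]; apply/dimvS/subvP=> z zZ.
by rewrite psiE // psiz ?a1 ?a2 ?mulr0 ?addr0 //; apply: Zc.
Qed.

(** If [phi] were 1 on the first class vector, its vanishing on [D] would relate [x_ i2] to [x_ i1]
    when [phi h = 0], or to [x_ j] when [phi h = 1]. Both contradict separation. *)
Lemma blocker_functional_eq0 D i1 i2 i3 g (phi : 'Hom('rV[F]_n, F^o)) :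
    q = 2%N -> good g -> class_triple i1 i2 i3 -> (exists2 j, i1 != j & e i1 j)
      ->
    (D <= good_span)%VS -> (forall u, u \in D -> phi u = 0) -> separated lam D
      ->
    phi (class_vec i3) = 0 ->
  phi (class_vec i1) = 0.
Proof.
move=> q2 gg tri [j i1j e1j] DE phiD sepD phi3; apply/eqP; apply: contraT => a1.
have [n12 n13 n23 _] := tri; have le_q i := card_cls_good e_equiv i gg.
(* Subtracting class vectors normalises [g] to a good word [h] that is zero at the representatives;
   at the partner [j] of [i1] it is then 1. *)
pose u := (x_ i1 g : F) *: class_vec i1 + (x_ i2 g : F) *: class_vec i2
        + (x_ i3 g : F) *: class_vec i3.
pose h := g + - u; have uE i : x_ i u =
    x_ i1 g * (e i1 i)%:R + x_ i2 g * (e i2 i)%:R + x_ i3 g * (e i3 i)%:R.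
  by rewrite !linearD !linearZ /= !coordf_class_vec.
have gh : good h.
  apply: good_addr gg _ => i l eil; rewrite !linearN /= !uE.
  by rewrite -!(equiv_sym e_equiv i) -!(equiv_sym e_equiv l) !(equiv_left
    e_equiv eil).
have h1 : x_ i1 h = 0.
  rewrite linearB /= uE (equiv_refl e_equiv) (equiv_sym e_equiv i2 i1)
    (equiv_sym e_equiv i3 i1).
  by rewrite (negPf n12) (negPf n13) !mulr0 !addr0 mulr1 subrr.
have h2 : x_ i2 h = 0.
  rewrite linearB /= uE (equiv_refl e_equiv) (equiv_sym e_equiv i3 i2).
  by rewrite (negPf n12) (negPf n23) !mulr0 addr0 add0r mulr1 subrr.
have hj : x_ j h = 1.
  by apply: two_element_field_eq1 => //; rewrite -h1 eq_sym (goodP _ _ _ gh).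
have decomp w : w \in D -> exists z c, [/\ x_ i1 w = x_ i1 z, x_ i2 w = x_ i2 z,
    x_ j w = x_ i1 z + c & x_ i1 z * phi (class_vec i1)
      + x_ i2 z * phi (class_vec i2) + c * phi h = 0].
  move=> wD; have wE := subvP (good_span_sub e_equiv gh) w (subvP DE w wD).
  case/memv_addP: wE => z zZ [_ /vlineP[c ->] wzc].
  have zc := binary_zero_sums_constant q2 le_q zZ; exists z, c.
  have xw i : x_ i w = x_ i z + c * x_ i h by rewrite wzc linearD linearZ.
  rewrite !xw h1 h2 hj (zc _ _ e1j) mulr0 mulr1 !addr0; split=> //.
  rewrite -(phiD w wD) wzc [RHS]linearD [in RHS]linearZ /=
    (functional_class_triple phi tri zc).
  by rewrite phi3 mulr0 addr0 (zc _ _ e1j).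
have nej : j != i2 by apply: contraNneq n12 => <-.
have ne1 : i1 != i2 by apply: contraNneq n12 => <-;
  rewrite (equiv_refl e_equiv).
have a1E := two_element_field_eq1 q2 a1; rewrite a1E in decomp.
have [c0|/(two_element_field_eq1 q2) c1] := eqVneq (phi h) 0.
  have [w /decomp[z [c [-> -> _ eq0]]] /eqP[]] := sepD i1 i2 (- phi (class_vec
    i2)) ne1.
  apply/eqP; rewrite -subr_eq0 mulNr opprK [phi _ * _]mulrC.
  by rewrite c0 mulr0 addr0 mulr1 in eq0; rewrite eq0.
have [w /decomp[z [c [_ -> -> eq0]]] /eqP[]] := sepD j i2 (- phi (class_vec
  i2)) nej.
apply/eqP; rewrite -subr_eq0 mulNr opprK [phi _ * _]mulrC addrAC.
by rewrite c1 !mulr1 in eq0; rewrite eq0.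
Qed.

(* A functional on E cutting out D takes the value 1 on each of the three class
   vectors, and so does the functional cutting out S in the space of class
   constant words; thus S would be contained in D. *)
Lemma star_binary_three_pairs g : good g -> q = 2%N -> #|P| = 3%N -> k = 3%N ->
    (forall i, exists2 j, i != j & e i j) ->
  is_star k (codes_above k S).
Proof.
move=> gg q2 P3 k3 dbl; have [dZ dE] := dim_good_span_eq2 gg q2.
have le_q i := card_cls_good e_equiv i gg.
have dE' : \dim good_span = k.+1 by rewrite dE P3 k3.
apply/(is_star_blocker k_gt0 dimS); split.
  by exists (S + <[g]>)%VS; apply: good_above.
case=> D bD;
  have [phi [phiE [s sS phis] sepD]] := star_blocker_functional gg dE' bD.
have [sub dSD] := star_blocker_good_span gg bD.
have DE : (D <= good_span)%VS.
  have /eqP -> : good_span == (S + D)%VS by rewrite eqEdim sub dSD dE' leqnn.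
  exact: addvSr.
have phiD u : u \in D -> phi u = 0.
  by move=> uD; apply/eqP; rewrite -phiE ?(subvP DE).
have [|psi psiE] := @hyperplane_functional _ _ S Z code_sub_zero_sums.
  by rewrite dZ P3 dimS k3.
have sc := S_constant sS.
have phi_neq0 i1 i2 i3 : class_triple i1 i2 i3 -> phi (class_vec i3) = 1.
  move=> tri; apply: (two_element_field_eq1 q2); apply: contraNneq phis => a3.
  have tri' := class_triple_swap tri.
  have z1 := blocker_functional_eq0 q2 gg tri (dbl i1) DE phiD sepD a3.
  have z2 := blocker_functional_eq0 q2 gg tri' (dbl i2) DE phiD sepD a3.
  by rewrite (functional_class_triple _ tri sc) z1 z2 a3 !mulr0 !addr0.
have psi_neq0 i1 i2 i3 : class_triple i1 i2 i3 -> psi (class_vec i3) = 1.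
  move=> tri; apply: (two_element_field_eq1 q2).
  apply: (code_functional_neq0 tri) => //; first by rewrite dZ P3 dimS k3.
  by move=> z; apply: binary_zero_sums_constant.
have [i1 [i2 [i3 tri]]] := class_triple_ex P3.
have tri1 := class_triple_rot tri; have tri2 := class_triple_rot tri1.
case/eqP: phis; rewrite (functional_class_triple _ tri sc).
rewrite (phi_neq0 _ _ _ tri) (phi_neq0 _ _ _ tri1) (phi_neq0 _ _ _ tri2).
have := functional_class_triple psi tri sc.
rewrite (psi_neq0 _ _ _ tri) (psi_neq0 _ _ _ tri1) (psi_neq0 _ _ _ tri2) => <-.
by apply/eqP; rewrite -psiE ?(subvP code_sub_zero_sums).
Qed.

(** * The exceptional quaternary case: one class of four columns *)

Lemma star_quaternary_line g : good g -> q = 4%N -> k = 2%N -> n = 4%N ->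
  (forall i j, e i j) -> is_star k (codes_above k S).
Proof.
move=> gg q4 k2 n4 eT; have EZ : good_span = Z by apply: good_span_gt2 gg _;
  rewrite q4.
have cI : #|'I_n| = 4%N by rewrite card_ord n4.
have clsT i : cls e i = [set: 'I_n]%SET by apply/setP=> j; rewrite !inE eT.
have QT : Q = [set [set: 'I_n]%SET]%SET.
  apply/setP=> X; rewrite !inE; apply/andP/eqP => [[/classesP[i ->] _]|->] //.
  rewrite cardsT cI q4 eqxx; split=> //.
  have [i _] := e_nontrivial; by rewrite -(clsT i) cls_class.
have memZ v : (v \in Z) = (\sum_i x_ i v == 0).
  have sumT : \sum_(i in [set: 'I_n]%SET) x_ i v = \sum_i x_ i v.
    by apply: eq_bigl => i; rewrite finset.in_setT.
  apply/mem_zero_sums/eqP => [v0|v0 X]; first by rewrite -sumT v0 // QT inE.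
  by rewrite QT inE => /eqP->; rewrite sumT.
(* The single class is full, so the span is cut out by one equation and has dimension
   [n - 1 = 3]. *)
have dE : \dim good_span = k.+1.
  by have := dim_zero_sums lam_neq0 e_equiv; rewrite EZ QT cards1 k2;
    move: n4; lia.
apply/(is_star_blocker k_gt0 dimS); split.
  by exists (S + <[g]>)%VS; apply: good_above.
case=> D bD;
  have [phi [phiE [s sS phis] sepD]] := star_blocker_functional gg dE bD.
have [sub dSD] := star_blocker_good_span gg bD.
have DE : (D <= good_span)%VS.
  have /eqP -> : good_span == (S + D)%VS by rewrite eqEdim sub dSD dE leqnn.
  exact: addvSr.
(* On E, where the coordinates sum to zero, the coefficients p of phi matter
  only
   up to a constant.  If p is injective its sum is zero and phi vanishes on S;
   otherwise phi reduces to a combination of two coordinates. *)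
pose p i : F := phi (of_coords lam (fun j => (j == i)%:R)).
have phip v : phi v = \sum_i p i * x_ i v.
  rewrite {1}(repr_coords lam_neq0 v) linear_sum; apply: eq_bigr => i _.
  by rewrite linearZ /= mulrC.
have [/injectiveP pinj|] := boolP (injectiveb p).
  case/eqP: phis; have [i _] := e_nontrivial.
  rewrite phip (eq_bigr (fun j => p j * x_ i s)) => [|j _]; last first.
    by rewrite (S_constant sS (eT i j)).
  rewrite -mulr_suml; have -> : \sum_j p j = \sum_(a : F) a.
    have pbij : bijective p by apply: inj_card_bij => //; rewrite cI q4.
    have [p' pK p'K] := pbij.
    by rewrite [RHS](reindex p) //; exists p' => ? _.
  by rewrite sum_field_gt2 ?mul0r // q4.
move=> /injectivePn[i [j ij pij]].
pose r l := p l - p i.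
have phir v : v \in Z -> phi v = \sum_l r l * x_ l v.
  rewrite memZ => /eqP v0; rewrite phip /r;
    under [RHS]eq_bigr do rewrite mulrBl.
  by rewrite sumrB -mulr_sumr v0 mulr0 subr0.
have ri : r i = 0 by rewrite /r subrr.
have rj : r j = 0 by rewrite /r pij subrr.
have [l rl] : exists l, r l != 0.
  apply: contrapT => no; case/eqP: phis.
  rewrite phir ?(subvP code_sub_zero_sums) // big1 // => l _.
  have [->|rl] := eqVneq (r l) 0; first by rewrite mul0r.
  by case: no; exists l.
have li : l != i by apply: contraNneq rl => ->; rewrite ri.
have lj : l != j by apply: contraNneq rl => ->; rewrite rj.
(* Of the four coefficients [r], those at [i] and [j] vanish, so only [l] and the remaining index
   [m] carry [phi]. *)
have [m [ml mi mj mE]] : exists m, [/\ m != l, m != i, m != j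
    & forall t, t != l -> t != m -> r t = 0].
  have c3 : #|[set l; i;
    j]%SET| = 3%N by rewrite -finset.setUA cardsU1 cards2 !inE negb_or li lj ij.
  have /cards1P[m mE] : #|~: [set l; i; j]%SET| == 1%N.
    by rewrite cardsCs finset.setCK c3 cI.
  have memm t : (t == m) = ~~ [|| t == l, t == i | t == j].
    by have /setP/(_ t) := mE; rewrite !inE -!orbA => <-.
  have := memm m; rewrite eqxx => /esym; rewrite !negb_or => /and3P[ml mi mj].
  exists m; split=> // t tl; rewrite memm (negPf tl) /= negbK.
  by case/orP=> /eqP->.
have [w wD /eqP] := sepD l m (- r m / r l) (introN eqP (fun lm => negP ml
  (introT eqP (esym lm)))).
apply; apply: (mulIf rl); rewrite mulrAC divfK //.
apply/eqP; rewrite -subr_eq0 mulNr opprK mulrC.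
have wZ : w \in Z by rewrite -EZ (subvP DE).
have : phi w == 0 by rewrite -phiE ?(subvP DE).
rewrite phir // (bigD1 l) //= (bigD1 m) //= big1 ?addr0 // => t /andP[tl tm].
by rewrite mE ?mul0r.
Qed.

(** [S] is then a line spanned by a word without zero entries, on which any two coordinates are
    proportional. *)
Lemma single_class : k = 2%N -> forall i j, e i j.
Proof.
move=> k2 i j; apply: contraT => nij.
have [s sS si] := S_neq0 i; have [t tS] := S_separated (x_ i s / x_ j s) nij.
have [s' s'S sj'] := S_neq0 j.
have /eqP Ss : <[s]>%VS == S.
  rewrite eqEdim -memvE sS dimS k2 dim_vline.
  by have -> // : s != 0; apply: contraNneq si => ->; rewrite linear0.
have sj : x_ j s != 0.
  apply: contraNneq sj' => sj; move: s'S; rewrite -Ss => /vlineP[c ->].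
  by rewrite linearZ /= sj /GRing.scale /= mulr0.
move: tS; rewrite -Ss => /vlineP[c ->]; rewrite !linearZ /= /GRing.scale /=.
by rewrite mulrCA divfK // eqxx.
Qed.

(** * Case analysis on the field size *)

Lemma star_codes_above : (1 < k < n.-1)%N ->
  is_star k (codes_above k S) <->
  (forall i, #|cls e i| <= q)%N /\ star_condition q k n #|P| #|L|.
Proof.
move=> /andP[k_gt1 ltkn].
have [le_q|nle_q] := pselect (forall i, (#|cls e i| <= q)%N); last first.
  by split=> [/(is_star_blocker k_gt0 dimS)[/above_ex]|[]].
have [g gg] := good_ex lam_neq0 e_equiv le_q.
have nge := card_coords_ge F e_equiv; have nle := card_coords_le e_equiv le_q.
have QL := card_full_repeated F e; have dZ := dim_zero_sums lam_neq0 e_equiv.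
have Pge := dim_code_le; rewrite dimS in Pge.
have L_gt0 : (0 < #|L|)%N.
  have [i [j /andP[ij eij]]] := e_nontrivial; apply/card_gt0P; exists (cls e i).
  by rewrite inE cls_class (card_cls_gt1 e_equiv ij).
have LP : (#|L| <= #|P|)%N.
  by apply/subset_leq_card/fintype.subsetP=> X /setIdP[].
have [q2|q_ge3] := eqVneq q 2%N.
  have [_ dE] := dim_good_span_eq2 gg q2.
  rewrite q2 subnn !mul0n !addn0 in nge nle.
  have reduce (b : Prop) : (is_star k (codes_above k S) <-> b) ->
    (b <-> ([/\ #|P| = k, k = 3%N & n = 6%N] \/ (k.+1 <= #|P|)%N)) ->
    is_star k (codes_above k S) <->
    (forall i, #|cls e i| <= q)%N /\ star_condition q k n #|P| #|L|.
    move=> -> ->; split=> [c|[_ [[_ //]|[]|[]|]]]; try by rewrite q2.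
    by split=> //; constructor 1.
  have [kP|Pk] : (k.+1 <= #|P|)%N \/ (#|P| <= k)%N by case: ltnP; [left|right].
    by apply: (reduce True); split=> // _; [apply: star_of_large_span gg _;
      rewrite dE|right].
  have [Pk1|Pk1] := eqVneq #|P| k.-1.
    apply: (reduce False); split=> //.
      by apply: (not_star_binary_full gg q2 Pk1); move: ltkn; lia.
    by case=> [[]|]; move: k_gt1; lia.
  have Pk' : #|P| = k by move: Pge Pk1 Pk k_gt1; lia.
  have [[b0 sb]|dbl] := pselect (exists b0, forall i, e b0 i -> i = b0).
    apply: (reduce False); split=> //.
      by apply: (not_star_singleton_class gg _ sb); rewrite dE Pk'.
    case=> [[_ k3 n6]|]; last by rewrite Pk' ltnn.
    (* A singleton class gives [#|L| < #|P| = 3], hence [n <= #|P| + #|L| < 6]. *)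
    have /proper_card : L \proper P.
      apply/properP; split; first by apply/fintype.subsetP=> X /setIdP[].
      exists (cls e b0); rewrite ?cls_class // inE cls_class /= -leqNgt.
      rewrite -(cards1 b0); apply/subset_leq_card/fintype.subsetP=> i.
      by rewrite !inE => /sb->.
    by move: nle QL; lia.
  have dbl' i : exists2 j, i != j & e i j.
    apply: contrapT => no'; apply: dbl; exists i => j eij; apply/eqP.
    by apply: contrapT => /negP ji; apply: no'; exists j; rewrite // eq_sym.
  have k_neq2 : k <> 2%N.
    move=> k2; have [r rE] := class_transversal.
    have P2 : (1 < #|P|)%N by rewrite Pk' k2.
    have := single_class k2 (r (Ordinal (ltnW P2))) (r (Ordinal P2)).
    by rewrite rE.
  have [k3|k_neq3] := eqVneq k 3%N.
    apply: (reduce True); split=> // _.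
      by apply: (star_binary_three_pairs gg) => //; rewrite Pk'.
    left; split=> //; have : (#|P| <= #|L|)%N.
      apply/subset_leq_card/fintype.subsetP=> X; rewrite !inE => PX; rewrite PX.
      case/classesP: PX => i ->; have [j ij eij] := dbl' i.
      exact: card_cls_gt1 ij eij.
    by move: nle nge QL LP; lia.
  apply: (reduce False); split=> //.
    by apply: (not_star_binary_doubled gg q2 Pk'); move: k_gt1; lia.
  by case=> [[_ /eqP]|]; rewrite ?(negPf k_neq3) // Pk' ltnn.
have q_gt2 : (2 < q)%N.
  by rewrite ltn_neqAle eq_sym q_ge3; exact: card_finNzRing_gt1.
rewrite -(good_span_gt2 gg q_gt2) in dZ.
(* The dimension is [n - #|Q|]. By the class counts it equals [#|P| + #|L|] for [q = 3] and is at
   least [k.+2] for [q >= 5]; for [q = 4] it drops to [k.+1] only in the configuration listed. *)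
have split_dim :
    (k.+1 < \dim good_span)%N /\ star_condition q k n #|P| #|L| \/
    \dim good_span = k.+1 /\
    (q = 3%N /\ (#|P| + #|L| = k.+1)%N \/
     [/\ q = 4%N, #|P| = k.-1, #|L| = 1%N & n = k.+2]).
  have [q5|q_le4] := leqP 5 q.
    left; split; last by constructor 4.
    have : (3 * #|Q| <= (q - 2) * #|Q|)%N by rewrite leq_mul2r; apply/orP;
      right; lia.
    by move: k_gt1; lia.
  have [q3|q_neq3] := eqVneq q 3%N.
    rewrite q3 !mul1n in nge nle.
    have [dE|dE] := ltnP k.+1 (\dim good_span); [left; split=> //|right; split].
    - constructor 2; split=> //.
      have [P1|P1] := eqVneq #|P| k.-1; first by constructor 1; split=> //; lia.
      have [P2|P2] := eqVneq #|P| k; first by constructor 2; split=> //; lia.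
      by constructor 3; lia.
    - lia.
    - by left; split=> //; lia.
  have q4 : q = 4%N by lia.
  rewrite q4 in nge nle.
  have [dE|dE] := ltnP k.+1 (\dim good_span); [left; split=> //|right; split].
  - constructor 3; split=> //.
    have [P1|P1] := eqVneq #|P| k.-1; last by constructor 3; lia.
    by constructor 2; split=> //; lia.
  - lia.
  - by right; split=> //; lia.
have q_neq2 : q <> 2%N by lia.
case: split_dim => [[dE cond]|[dE cond]].
  split=> _; first by [].
  exact: star_of_large_span gg dE.
have [P2|P1] := ltnP 1 #|P|.
  have nstar := not_star_gt2 gg q_gt2 dE P2.
  split=> [//|[_ c]]; exfalso.
  case: cond c => [[q3 PL]|[q4 Pk L1 nk]].
    by case=> [[/q_neq2]|[_ [[]|[]|]]|[]|]; lia.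
  by case=> [[/q_neq2]|[]|[_ [[]|[]|]]|]; lia.
(* With a single class [k = 2]. Then [#|P| + #|L| <= 2 < k.+1] excludes [q = 3], and the quaternary
   exception remains. *)
have Pk : #|P| = k.-1 by lia.
have k2 : k = 2%N by lia.
case: cond => [[q3 PL]|[q4 _ L1 nk]]; first by lia.
split=> _.
  by split=> //; constructor 3; split=> //; constructor 1; rewrite Pk k2.
apply: (star_quaternary_line gg q4 k2); first by rewrite nk k2.
exact: single_class.
Qed.
End StarOfCode.

(** * Scaling the columns of a generator matrix *)

Lemma col_equiv_equivalence (F : finFieldType) m n (M : 'M[F]_(m, n)) :
  equivalence_rel (col_equiv M).
Proof.
have sym i j : col_equiv M i j -> col_equiv M j i.
  case/existsP=> a /andP[a0 /eqP cj]; apply/existsP; exists a^-1.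
  by rewrite invr_eq0 a0 cj scalerA mulVf // scale1r /=.
have trans i j l : col_equiv M i j -> col_equiv M j l -> col_equiv M i l.
  case/existsP=> a /andP[a0 /eqP cj] /existsP[b /andP[b0 /eqP cl]].
  by apply/existsP; exists (b * a); rewrite mulf_neq0 // cl cj scalerA /=.
move=> i j l; split=> [|eij].
  by apply/existsP; exists 1; rewrite oner_neq0 scale1r /=.
by apply/idP/idP; apply: trans => //; apply: sym.
Qed.

(** Equivalent columns define the same predicate, for which [pick] returns the same representative;
    [lam] holds the ratios to it. *)
Lemma class_scaling (F : finFieldType) m n (M : 'M[F]_(m, n)) :
  exists (r : 'I_n -> 'I_n) (lam : 'I_n -> F),
    [/\ forall i, lam i != 0, forall i, col i M = lam i *: col (r i) M
      & forall i j, col_equiv M i j -> r i = r j].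
Proof.
have e_equiv := col_equiv_equivalence M.
pose r j := odflt j [pick i | col_equiv M j i].
have rE i : col_equiv M (r i) i.
  rewrite (equiv_sym e_equiv) /r; case: pickP => //= /(_ i).
  by rewrite (equiv_refl e_equiv).
pose lam i := xchoose (existsP (rE i)).
have lamP i := andP (xchooseP (existsP (rE i))).
exists r, lam; split=> [i|i|i j eij]; first by case: (lamP i).
  by apply/eqP; case: (lamP i).
rewrite /r;
  have /eq_pick-> : col_equiv M i =1 col_equiv M j by apply: equiv_left.
by case: pickP => // /(_ j); rewrite (equiv_refl e_equiv).
Qed.

Lemma is_star_codes_above (F : finFieldType) (n k : nat) (S : {vspace 'rV[F]_n})
    (M : 'M[F]_(k.-1, n)) :
    (1 < k < n.-1)%N -> \dim S = k.-1 -> nondegenerate_code S ->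
    ~ projective_code S -> generator_matrix M S ->
  is_star k (codes_above k S) <->
  (forall j, #|col_class M j| <= #|F|)%N /\
  star_condition #|F| k n #|col_classes M| #|repeated_col_classes M|.
Proof.
move=> hk dimS ndegS nprojS genM; have [k_gt1 ltkn] := andP hk.
have [k_gt0 n_gt1] : (0 < k)%N /\ (1 < n)%N by move: k_gt1 ltkn; lia.
have e_equiv := col_equiv_equivalence M.
have [r [lam [lam_neq0 lamE r_class]]] := class_scaling M.
have entryE i s : s \in S -> s 0 i = lam i * s 0 (r i).
  by move=> sS; apply: ((generator_colE _ _ _ genM).1 (lamE i)).
have col_neq0 i : col i M != 0.
  have [s sS] := nondegenerate_codeP i ndegS; apply: contraNneq => coli.
  have := (generator_colE i i 0 genM).1;
    rewrite coli scale0r => /(_ erefl s sS)->.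
  by rewrite mul0r.
(* On [S] the rescaled coordinate is the entry at the class representative, so it depends only on
   the class. *)
have coordE i s : s \in S -> coordf lam i s = s 0 (r i).
  by move=> sS; rewrite coordfE (entryE i s sS); apply: (mulIf (lam_neq0 i));
    rewrite divfK // mulrC.
apply: (star_codes_above (lam := lam) (e := col_equiv M)) => //.
- by move=> s sS i j eij; rewrite !coordE // (r_class i j).
(* A relation holding on all of [S] makes the columns proportional; the ratio [c] is nonzero because
   column [i] is. *)
- move=> i j b; apply: contraNP => no; pose c := lam i * b / lam j.
  have colE : col i M = c *: col j M.
    apply/(generator_colE _ _ _ genM) => s sS.
    have [eq_s|neq] := eqVneq (coordf lam i s) (b * coordf lam j s); last first.
      by case: no; exists s.
    rewrite (entryE i s sS) (entryE j s sS) -coordE // eq_s coordE //.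
    by rewrite /c [RHS]mulrA divfK // -mulrA.
  rewrite (equiv_sym e_equiv); apply/existsP; exists c; rewrite colE eqxx andbT.
  by apply: contraNneq (col_neq0 i) => c0; rewrite colE c0 scale0r.
- move=> i; have [s sS si] := nondegenerate_codeP i ndegS; exists s => //.
  by rewrite coordfE mulf_neq0 ?invr_eq0.
- apply: contrapT => no; apply: nprojS; exists k.-1, M; split=> //.
  split=> // i j ij; apply/negP => eij.
  by apply: no; exists i, j; rewrite ij.
Qed.

Local Close Scope ring_scope.
Local Close Scope classical_set_scope.

Theorem theorem1 (F : finFieldType) (n k : nat) (hk : 1 < k < n.-1)
    (S : {vspace 'rV[F]_n}) (dimS : \dim S = k.-1)
    (ndegS : nondegenerate_code S) (nprojS : ~ projective_code S)
    (M : 'M[F]_(k.-1, n)) (genM : generator_matrix M S) :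
  let q := #|F| in
  let l := #|col_classes M| in
  let L := repeated_col_classes M in
  is_star k (codes_above k S) <->
  (forall j : 'I_n, #|col_class M j| <= q) /\
  [\/ q = 2 /\ ([/\ l = k, k = 3 & n = 6] \/ k.+1 <= l),
      q = 3 /\ [\/ l = k.-1 /\ 3 <= #|L|, l = k /\ 2 <= #|L| | k.+1 <= l],
      q = 4 /\ [\/ l = k.-1 /\ k.-1 = 1, l = k.-1 /\ 2 <= #|L| | k <= l]
    | 5 <= q].
Proof. exact: is_star_codes_above. Qed.
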